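(* Let $(X_0,\|\cdot\|,\tau)$ satisfy Assumption (S) of the context and let $(T(t))_{t\ge0}$ be a bi-continuous semigroup on $X_0$ with generator $A$, where $0\in\rho(A)$. For each $n\in\mathbb{Z}$ the semigroup $(T_n(t))_{t\ge0}$ is bi-continuous on $X_n$ (with respect to $\tau_n$) with generator $A_n:X_{n+1}\to X_n$. Its space of norm strong continuity is $\underline{X}_n$, i.e. $\underline{X}_n$ is the set of all $x\in X_n$ such that $t\mapsto T_n(t)x$ is $\|\cdot\|_{X_n}$-continuous.
   Context: Assumption (S) on a triple $(X_0,\|\cdot\|,\tau)$: $(X_0,\|\cdot\|)$ is a Banach space; (1) $\tau$ is a locally convex Hausdorff topology coarser than the norm topology; (2) $\tau$ is sequentially complete on the closed unit ball; (3) $\|x\|=\sup\{|\varphi(x)|:\varphi\in(X_0,\tau)',\|\varphi\|\le1\}$. Equivalently to (3), there is a set $\mathcal{P}$ of $\tau$-continuous seminorms defining $\tau$ with $\|x\|=\sup_{p\in\mathcal{P}}p(x)$; fix such $\mathcal{P}$. A bi-continuous semigroup on such a triple is a family $(T(t))_{t\ge0}$ in $\mathscr{L}(X_0)$ with: $T(0)=I$, $T(t+s)=T(t)T(s)$; $t\mapsto T(t)x$ $\tau$-continuous for every $x$; $\|T(t)\|\le Me^{\omega t}$ for some $M\ge1$, $\omega\in\mathbb{R}$; and for each norm-bounded $\tau$-null sequence $(x_n)$ and $t_0\ge0$, $T(s)x_n\to0$ in $\tau$ uniformly for $s\in[0,t_0]$. Generator: $Ax:=\tau\text{-}\lim_{t\to0}\frac{T(t)x-x}{t}$,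 $D(A):=\{x:\tau\text{-}\lim_{t\to0}\frac{T(t)x-x}{t}\text{ exists and }\sup_{t\in(0,1]}\frac{\|T(t)x-x\|}{t}<\infty\}$. Spaces. $\underline{X}_0:=\overline{D(A)}$ (norm closure), $\underline{A}$ the part of $A$ in $\underline{X}_0$ (densely defined in $\underline{X}_0$). For $n\ge1$: $X_n:=D(A^n)$ with norm $\|A^nx\|$, $\underline{X}_n:=D(\underline{A}^n)$ with norm $\|\underline{A}^nx\|$; for $n\ge0$, $A_n$ is the part of $A$ in $X_n$ (domain $X_{n+1}$). $\underline{X}_{-1}$ is the completion of $X_0$ for $\|x\|_{\underline{X}_{-1}}:=\|A^{-1}x\|$, and $\underline{A}_{-1}:\underline{X}_0\to\underline{X}_{-1}$ the unique continuous extension of $A:(D(A),\|\cdot\|)\to(X_0,\|\cdot\|_{\underline{X}_{-1}})$. For $n\ge2$, $\underline{X}_{-n}$ is the completion of $\underline{X}_{-n+1}$ for $\|\underline{A}_{-n+1}^{-1}x\|_{\underline{X}_{-n+1}}$, and $\underline{A}_{-n}:\underline{X}_{-n+1}\to\underline{X}_{-n}$ the unique continuous extension of $\underline{A}_{-n+1}$; all are isometric isomorphisms, and $\underline{X}_0\subseteq X_0\subseteq\underline{X}_{-1}\subseteq\underline{X}_{-2}\subseteq\cdots$. For $n\ge1$ recursively $X_{-n}:=\underline{A}_{-n-1}(X_{-n+1})\subseteq\underline{X}_{-n-1}$ with norm $\|\underline{A}_{-n-1}^{-1}x\|_{X_{-n+1}}$, and $A_{-n}:X_{-n+1}\to X_{-n}$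 is the restriction of $\underline{A}_{-n-1}$; one has $\underline{X}_{-n}\subseteq X_{-n}$. Each $A_n$ ($n\in\mathbb{Z}$) is an isometric isomorphism $X_{n+1}\to X_n$ and is also viewed as an operator on $X_n$ with domain $X_{n+1}$. Topologies and semigroups. Put $\mathcal{P}_0:=\mathcal{P}$, $\tau_0:=\tau$, $T_0(t):=T(t)$. For $n\ge0$ recursively: $\mathcal{P}_{n+1}:=\{x\mapsto p(A_nx):p\in\mathcal{P}_n\}$ on $X_{n+1}$, $\tau_{n+1}$ the topology it defines, $T_{n+1}(t):=A_n^{-1}T_n(t)A_n$; and $\mathcal{P}_{-n-1}:=\{x\mapsto p(A_{-n-1}^{-1}x):p\in\mathcal{P}_{-n}\}$ on $X_{-n-1}$, $\tau_{-n-1}$ the topology it defines, $T_{-n-1}(t):=A_{-n-1}T_{-n}(t)A_{-n-1}^{-1}$. *)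

(* Defs.v *)
From HB Require Import structures.
From mathcomp Require Import all_boot all_order all_algebra.
From mathcomp Require Import complex.
From mathcomp Require Import all_classical all_reals all_analysis.

Set Implicit Arguments.
Unset Strict Implicit.
Unset Printing Implicit Defensive.

Import Order.TTheory GRing.Theory Num.Theory.
Import numFieldNormedType.Exports.

Local Open Scope classical_set_scope.
Local Open Scope ring_scope.

(* Banach spaces are real or complex; norms and seminorms take their values in
   the real field R in both cases. *)
Variant scalar_kind := RealScalars | ComplexScalars.

Definition base_field (R : realType) (k : scalar_kind) : numFieldType :=
  match k with RealScalars => R | ComplexScalars => complex R end.

Definition sabs (R : realType) (k : scalar_kind) : base_field R k -> R :=
  match k with
  | RealScalars => fun x : R => `|x|
  | ComplexScalars => fun z : complex R => complex.Re `|z|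
  end.

Definition sofR (R : realType) (k : scalar_kind) : R -> base_field R k :=
  match k with
  | RealScalars => fun x : R => x
  | ComplexScalars => fun x : R => Complex x 0
  end.

Arguments sabs {R k}.
Arguments sofR {R} k.

(* All the spaces of the scale (X_n) carry different norms and are related by
   set inclusions. They are therefore represented as pairs (carrier, norm)
   inside one ambient vector space E, whose role is only to make sense of the
   inclusions. The values of a norm, a seminorm or an operator outside its
   carrier are irrelevant. *)
Record nspace (R : realType) (k : scalar_kind)
    (E : lmodType (base_field R k)) :=
  NSpace { carrier :> set E ; nrm : E -> R }.

(* A linear operator with its domain; only the values on [dom] matter. *)
Record operator (R : realType) (k : scalar_kind)
    (E : lmodType (base_field R k)) :=
  Operator { dom : set E ; opfun :> E -> E }.

Section BiContinuous.
Context {R : realType} {k : scalar_kind} {E : lmodType (base_field R k)}.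
Implicit Types (X Y Z : nspace E) (V D : set E) (P : set (E -> R)).
Implicit Types (T : R -> E -> E) (A B : operator E).

Definition subspace V :=
  V 0 /\ forall (a : base_field R k) x y, V x -> V y -> V (a *: x + y).

Definition linear_on V (f : E -> E) :=
  forall (a : base_field R k) x y, V x -> V y -> f (a *: x + y) = a *: f x + f y.

Definition functional_on V (phi : E -> base_field R k) :=
  forall (a : base_field R k) x y, V x -> V y ->
    phi (a *: x + y) = a * phi x + phi y.

Definition seminorm_on V (p : E -> R) :=
  (forall (a : base_field R k) x, V x -> p (a *: x) = sabs a * p x) /\
  (forall x y, V x -> V y -> p (x + y) <= p x + p y).

Definition norm_on V (p : E -> R) :=
  seminorm_on V p /\ (forall x, V x -> p x = 0 -> x = 0).

(* Neighbourhoods of x in V for the topology defined by the family P: they are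
   generated by the finite intersections of open P-balls. With P = [set nrm X]
   this is the norm topology of X. *)
Definition snbhs V P (x : E) : set_system E :=
  filter_from
    [set Fe : set (E -> R) * R |
       [/\ finite_set Fe.1, Fe.1 `<=` P & 0 < Fe.2]]
    (fun Fe => [set y | V y /\ forall p, Fe.1 p -> p (y - x) < Fe.2]).

Definition closure_in V P D : set E :=
  [set x | V x /\ forall U, snbhs V P x U -> D `&` U !=set0].

Definition hausdorff_in V P :=
  forall x y, V x -> V y -> x <> y ->
    exists U W, [/\ snbhs V P x U, snbhs V P y W & U `&` W = set0].

Definition cauchy_in V P (u : nat -> E) :=
  forall U, snbhs V P 0 U -> exists n0 : nat, forall m n : nat,
    (n0 <= m)%N -> (n0 <= n)%N -> U (u m - u n).

Definition seq_complete_on V P D :=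
  forall u : nat -> E, (forall n, D (u n)) -> cauchy_in V P u ->
    exists x, D x /\ u @ \oo --> snbhs V P x.

Definition banach X :=
  [/\ subspace X, norm_on X (nrm X) & seq_complete_on X [set nrm X] X].

Definition unit_ball X : set E := [set x | carrier X x /\ nrm X x <= 1].

(* The functionals of norm at most 1 in the dual of X for the topology
   defined by P. *)
Definition dual_unit_ball X P : set (E -> base_field R k) :=
  [set phi | [/\ functional_on X phi,
     forall x, carrier X x -> forall e : R, 0 < e ->
       \forall y \near snbhs X P x, sabs (phi y - phi x) < e
   & forall x, carrier X x -> sabs (phi x) <= nrm X x]].

(* Assumption (S) for X and the locally convex topology defined by P. *)
Record assumption_S X P : Prop := AssumptionS {
  aS_banach : banach X ;
  aS_seminorms : forall p, P p -> seminorm_on X p ;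
  aS_hausdorff : hausdorff_in X P ;
  aS_coarser : forall x, carrier X x ->
    snbhs X P x `<=` snbhs X [set nrm X] x ;
  aS_seq_complete : seq_complete_on X P (unit_ball X) ;
  aS_norming : forall x, carrier X x ->
    ereal_sup [set (sabs (phi x))%:E | phi in dual_unit_ball X P]
      = (nrm X x)%:E }.

Definition norming X P :=
  forall x, carrier X x -> ereal_sup [set (p x)%:E | p in P] = (nrm X x)%:E.

Definition bounded_operator X (f : E -> E) :=
  [/\ forall x, carrier X x -> carrier X (f x), linear_on X f &
      exists C : R, forall x, carrier X x -> nrm X (f x) <= C * nrm X x].

Definition strongly_continuous_at X P T (x : E) :=
  forall t : R, 0 <= t ->
    (fun s : R => T s x) @ within [set s : R | 0 <= s] (nbhs t)
      --> snbhs X P (T t x).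

Record bicontinuous_semigroup X P T : Prop := BicontinuousSemigroup {
  bs_assumption_S : assumption_S X P ;
  bs_bounded : forall t : R, 0 <= t -> bounded_operator X (T t) ;
  bs_id : forall x, carrier X x -> T 0 x = x ;
  bs_add : forall (t s : R) x, 0 <= t -> 0 <= s -> carrier X x ->
    T (t + s) x = T t (T s x) ;
  bs_continuous : forall x, carrier X x -> strongly_continuous_at X P T x ;
  bs_exp_bounded : exists M omega : R, 1 <= M /\
    forall (t : R) x, 0 <= t -> carrier X x ->
      nrm X (T t x) <= M * expR (omega * t) * nrm X x ;
  bs_bi_equicontinuous : forall u : nat -> E,
    (forall n, carrier X (u n)) ->
    (exists C : R, forall n, nrm X (u n) <= C) ->
    u @ \oo --> snbhs X P 0 ->
    forall t0 : R, 0 <= t0 -> forall U, snbhs X P 0 U ->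
      \forall n \near \oo, forall s : R, 0 <= s <= t0 -> U (T s (u n)) }.

Definition quotient_limit X P T (x y : E) :=
  carrier X y /\
  (fun t : R => (sofR k t)^-1 *: (T t x - x)) @ 0^'+ --> snbhs X P y.

Definition generator X P T : operator E := {|
  dom := [set x | [/\ carrier X x, exists y, quotient_limit X P T x y &
    has_ubound [set nrm X (T t x - x) / t | t in `]0, 1]%classic]]] ;
  opfun := fun x => xget 0 [set y | quotient_limit X P T x y] |}.

Definition same_operator A B :=
  dom A = dom B /\ forall x, dom A x -> A x = B x.

Definition resolvent_set X A : set (base_field R k) :=
  [set l | set_bij (dom A) X (fun x => l *: x - A x) /\
     exists C : R, forall x, dom A x -> nrm X x <= C * nrm X (l *: x - A x)].

Definition inverse_on D (f : E -> E) : E -> E := 'pinv_(fun=> 0) D f.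

Definition op_inv A : E -> E := inverse_on (dom A) A.

Definition part A D : operator E :=
  {| dom := [set x | [/\ dom A x, D x & D (A x)]] ; opfun := A |}.

(* The domain of A^n, for A an operator in V. *)
Fixpoint dom_pow V A (n : nat) : set E :=
  if n is m.+1 then [set x | dom A x /\ dom_pow V A m (A x)] else V.

(* W is a completion of V for the norm p. *)
Definition completion_of V (p : E -> R) (W : nspace E) :=
  [/\ banach W, V `<=` W, forall x, V x -> nrm W x = p x &
      W `<=` closure_in W [set nrm W] V].

(* f : Y -> Z is the continuous extension to Y of g : D -> Z. *)
Definition continuous_extension D (g : E -> E) Y Z (f : E -> E) :=
  [/\ forall y, carrier Y y -> carrier Z (f y), forall x, D x -> f x = g x &
      forall y, carrier Y y ->
        f @ snbhs Y [set nrm Y] y --> snbhs Z [set nrm Z] (f y)].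

(* \underline X_0 *)
Definition under0 X A : nspace E :=
  {| carrier := closure_in X [set nrm X] (dom A) ; nrm := nrm X |}.

(* [Xu n] stands for \underline X_{-n} (n >= 0) and [Au n] for
   \underline A_{-n} : \underline X_{-n+1} -> \underline X_{-n} (n >= 1;
   [Au 0] is not used). Each completion is any Banach space of E containing the
   space to be completed isometrically as a dense subspace. *)
Record extrapolation_tower X A (Xu : nat -> nspace E) (Au : nat -> E -> E) :
    Prop := ExtrapolationTower {
  et_zero : Xu 0 = under0 X A ;
  et_space1 : completion_of X (fun x => nrm X (op_inv A x)) (Xu 1) ;
  et_op1 : continuous_extension (dom A) A (Xu 0) (Xu 1) (Au 1) ;
  et_space : forall n, (1 <= n)%N ->
    completion_of (Xu n)
      (fun x => nrm (Xu n) (inverse_on (Xu n.-1) (Au n) x)) (Xu n.+1) ;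
  et_op : forall n, (1 <= n)%N ->
    continuous_extension (Xu n.-1) (Au n) (Xu n) (Xu n.+1) (Au n.+1) }.

End BiContinuous.

Section Scale.
Context {R : realType} {k : scalar_kind} {E : lmodType (base_field R k)}.
Variables (X : nspace E) (P : set (E -> R)) (T : R -> E -> E).
Variables (Xu : nat -> nspace E) (Au : nat -> E -> E).

Let A := generator X P T.

Definition Xpos (n : nat) : nspace E :=
  {| carrier := dom_pow X A n ; nrm := fun x => nrm X (iter n A x) |}.

Definition Apos (n : nat) : operator E := part A (Xpos n).

Fixpoint Ppos (n : nat) : set (E -> R) :=
  if n is m.+1 then [set (fun x => p (Apos m x)) | p in Ppos m] else P.

Fixpoint Tpos (n : nat) : R -> E -> E :=
  if n is m.+1 then fun t x => op_inv (Apos m) (Tpos m t (Apos m x)) else T.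

(* X_{-n} *)
Fixpoint Xneg (n : nat) : nspace E :=
  if n is m.+1 then
    {| carrier := Au m.+2 @` Xneg m ;
       nrm := fun x => nrm (Xneg m) (inverse_on (Xu m.+1) (Au m.+2) x) |}
  else X.

(* A_{-n} : X_{-n+1} -> X_{-n}, for n = m.+1 *)
Definition Aneg (m : nat) : operator E :=
  {| dom := Xneg m ; opfun := Au m.+2 |}.

Fixpoint Pneg (n : nat) : set (E -> R) :=
  if n is m.+1 then [set (fun x => p (op_inv (Aneg m) x)) | p in Pneg m]
  else P.

Fixpoint Tneg (n : nat) : R -> E -> E :=
  if n is m.+1 then fun t x => Aneg m (Tneg m t (op_inv (Aneg m) x)) else T.

(* Recall that [Negz m] is the integer -(m + 1). *)
Definition scale_space (n : int) : nspace E :=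
  match n with Posz m => Xpos m | Negz m => Xneg m.+1 end.

Definition scale_operator (n : int) : operator E :=
  match n with Posz m => Apos m | Negz m => Aneg m end.

Definition scale_seminorms (n : int) : set (E -> R) :=
  match n with Posz m => Ppos m | Negz m => Pneg m.+1 end.

Definition scale_semigroup (n : int) : R -> E -> E :=
  match n with Posz m => Tpos m | Negz m => Tneg m.+1 end.

(* \underline X_n *)
Definition under_space (n : int) : set E :=
  match n with
  | Posz m => dom_pow (under0 X A) (part A (under0 X A)) m
  | Negz m => Xu m.+1
  end.

End Scale.

(* A normed module of the library is an [nspace] with full carrier; its topology
   is given by [snbhs] and its completeness implies [banach]. *)
Definition real_lmod (R : realType) (E : normedModType R) :
  lmodType (base_field R RealScalars) := E.

Definition real_nspace (R : realType) (E : normedModType R) :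
    nspace (real_lmod E) :=
  {| carrier := [set: real_lmod E]; nrm := fun x : E => `|x| |}.

Lemma snbhs_real_nspace (R : realType) (E : normedModType R) (x : real_lmod E) :
  snbhs (real_nspace E) [set nrm (real_nspace E)] x = nbhs (x : E).
Proof.
apply/seteqP; split => U.
  case=> -[F e] /= [_ FN e0] FU.
  apply/nbhs_ballP; exists e => // y; rewrite -ball_normE /= => xy.
  by apply: FU; split=> // p /FN /= ->; rewrite distrC.
move=> /nbhs_ballP[e /= e0 eU].
exists ([set nrm (real_nspace E)], e) => /=.
  by split => //; exact: finite_set1.
move=> y /= [_ /(_ _ erefl)] ye; apply: eU; rewrite -ball_normE /= distrC //.
Qed.

Lemma banach_real_nspace (R : realType) (E : completeNormedModType R) :
  banach (real_nspace E).
Proof.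
split.
- by split.
- split; first by split => [a x _|x y _ _];
    [exact: (@normrZ _ E)|exact: (@ler_normD _ E)].
  by move=> x _ /eqP; rewrite normr_eq0 => /eqP.
- move=> u _ cu.
  have cv : cvgn (u : nat -> E).
    apply/cauchy_cvgP/cauchy_ballP => e e0.
    have [|n0 hn] := cu (ball (0 : E) e).
      by rewrite snbhs_real_nspace; exact: nbhsx_ballx.
    exists (u @` [set n | (n0 <= n)%N], u @` [set n | (n0 <= n)%N]).
      by split; exists n0 => // n n0n; exists n.
    move=> [_ _] /= [[m n0m <-] [n n0n <-]]; have := hn m n n0m n0n.
    by rewrite -!ball_normE /= sub0r normrN.
  exists (lim (u @ \oo)); split=> //; by rewrite snbhs_real_nspace.
Qed.

(* Main.v *)
Require Import Defs.
From HB Require Import structures.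
From mathcomp Require Import all_boot all_order all_algebra.
From mathcomp Require Import complex.
From mathcomp Require Import all_classical all_reals all_analysis.
From mathcomp Require Import lra.
(* MathComp-Analysis has its own [subspace]. *)
Import Defs.

(* Each [A_n : X_{n+1} -> X_n] is an isometric isomorphism carrying [tau_{n+1}]
   to [tau_n] and [T_{n+1}] to [T_n]. Bi-continuity, the generator and the space
   of norm strong continuity are transported along such isomorphisms, which
   reduces everything to [n = 0] and to identifying the transported objects.

   For [n = 0], vectors of [D(A)] have Lipschitz orbits, so the closure of [D(A)]
   consists of vectors of norm strong continuity. Conversely, if the orbit of [x]
   is norm continuous and [z = A^-1 x], then for every seminorm [p] of [P] the
   function [s |-> p(T(s)z - z - s x)] has upper right Dini derivative at most
   [p(T(s)x - x) <= |T(s)x - x|], whence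
   [|T(t)z - z - t x| <= t sup_(s <= t) |T(s)x - x|], and the vectors
   [(T(t)z - z) / t] of [D(A)] converge to [x] in norm.

   For [n < 0], a continuous extension of a linear isometry with dense range
   between Banach spaces is onto, so every
   [\underline A_{-n} : \underline X_{-n+1} -> \underline X_{-n}] is an isometric
   isomorphism; it is extended by [\underline A_{-n-1}], which transports
   [\underline X_{-n+1}] to [\underline X_{-n}] and [X_{-n+1}] to [X_{-n}]. *)

Set Implicit Arguments.
Unset Strict Implicit.
Unset Printing Implicit Defensive.

Import Order.TTheory GRing.Theory Num.Theory.
Import numFieldNormedType.Exports.

Local Open Scope classical_set_scope.
Local Open Scope ring_scope.

(** * The embedding of the reals in the scalar field and the modulus with real values *)

Section Scalars.
Context {R : realType} {k : scalar_kind}.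
Implicit Types (s t : R) (a b : base_field R k).

Lemma sofR0 : sofR k 0 = 0 :> base_field R k. Proof. by case: k. Qed.
Lemma sofR1 : sofR k 1 = 1 :> base_field R k. Proof. by case: k. Qed.
Lemma sofRD s t : sofR k (s + t) = sofR k s + sofR k t.
Proof. by case: k => //=; rewrite -[RHS]/(Complex _ _) addr0. Qed.
Lemma sofRN s : sofR k (- s) = - sofR k s.
Proof. by apply/eqP; rewrite -addr_eq0 -sofRD addNr sofR0. Qed.
Lemma sofRB s t : sofR k (s - t) = sofR k s - sofR k t.
Proof. by rewrite sofRD sofRN. Qed.
Lemma sofRM s t : sofR k (s * t) = sofR k s * sofR k t.
Proof.
by case: k => //=; rewrite -[RHS]/(Complex _ _) !mulr0 mul0r subr0 addr0.
Qed.
Lemma sofR_eq0 s : (sofR k s == 0) = (s == 0).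
Proof. by case: k => //=; rewrite eq_complex /= eqxx andbT. Qed.
Lemma sofRV s : (sofR k s)^-1 = sofR k s^-1.
Proof.
have [->|s0] := eqVneq s 0; first by rewrite invr0 sofR0 invr0.
apply: (@mulfI _ (sofR k s)); first by rewrite sofR_eq0.
by rewrite -sofRM !divff ?sofR_eq0// sofR1.
Qed.
Lemma sabs_sofR s : sabs (sofR k s) = `|s|.
Proof. by case: k => //=; rewrite expr0n addr0 sqrtr_sqr. Qed.
Lemma sabs_ge0 a : 0 <= sabs a.
Proof. by case: k a => //= -[a b] /=; rewrite sqrtr_ge0. Qed.
Lemma sabsN1 : sabs (-1 : base_field R k) = 1.
Proof. by rewrite -sofR1 -sofRN sabs_sofR normrN1. Qed.
Lemma sabs0 : sabs (0 : base_field R k) = 0.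
Proof. by rewrite -sofR0 sabs_sofR normr0. Qed.
End Scalars.

(** * Seminorm topologies *)
Section Seminorms.
Context {R : realType} {k : scalar_kind} {E : lmodType (base_field R k)}.
Implicit Types (V : set E) (P : set (E -> R)) (p : E -> R) (x y : E).

Lemma subspaceD V x y : subspace V -> V x -> V y -> V (x + y).
Proof. by case=> _ sV Vx Vy; rewrite -(scale1r x); apply: sV. Qed.

Lemma subspaceZ V a x : subspace V -> V x -> V (a *: x).
Proof. by case=> V0 sV Vx; rewrite -(addr0 (a *: x)); apply: sV. Qed.

Lemma subspaceB V x y : subspace V -> V x -> V y -> V (x - y).
Proof.
by move=> sV Vx Vy; apply: subspaceD => //; rewrite -scaleN1r; apply: subspaceZ.
Qed.

Lemma subspace_linearB V f x y :
  subspace V -> linear_on V f -> V x -> V y -> f (x - y) = f x - f y.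
Proof.
by move=> sV lf Vx Vy; rewrite addrC -scaleN1r lf// scaleN1r addrC.
Qed.

Lemma subspace_linearD V f x y :
  subspace V -> linear_on V f -> V x -> V y -> f (x + y) = f x + f y.
Proof. by move=> sV lf Vx Vy; rewrite -{1}(scale1r x) lf// scale1r. Qed.

Lemma subspace_linear0 V f : subspace V -> linear_on V f -> f 0 = 0.
Proof.
move=> sV lf; have [V0 _] := sV.
by have := subspace_linearB sV lf V0 V0; rewrite !subrr.
Qed.

Lemma subspace_linearZ V f a x :
  subspace V -> linear_on V f -> V x -> f (a *: x) = a *: f x.
Proof.
move=> sV lf Vx; rewrite -[a *: x]addr0 lf//; last by case: sV.
by rewrite (subspace_linear0 sV)// addr0.
Qed.

Lemma seminorm0 V p : subspace V -> seminorm_on V p -> p 0 = 0.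
Proof. by case=> V0 _ [/(_ 0 _ V0) + _]; rewrite scale0r sabs0 mul0r. Qed.

Lemma seminormN V p x : seminorm_on V p -> V x -> p (- x) = p x.
Proof. by move=> [pZ _] Vx; rewrite -scaleN1r pZ// sabsN1 mul1r. Qed.

Lemma seminorm_distC V p x y :
  subspace V -> seminorm_on V p -> V x -> V y -> p (x - y) = p (y - x).
Proof.
by move=> sV sp Vx Vy; rewrite -opprB (seminormN sp)//; apply: subspaceB.
Qed.

(** This comes from [0 = p (x - x) <= p x + p (- x) = 2 p x]. *)
Lemma seminorm_ge0 V p x : subspace V -> seminorm_on V p -> V x -> 0 <= p x.
Proof.
move=> sV sp Vx; have := sp.2 x (- x) Vx; rewrite subrr (seminorm0 sV sp).
rewrite (seminormN sp)// -scaleN1r => /(_ (subspaceZ _ sV Vx)); lra.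
Qed.

Lemma seminormZ_sofR V p (s : R) x :
  seminorm_on V p -> V x -> p (sofR k s *: x) = `|s| * p x.
Proof. by move=> [pZ _] Vx; rewrite pZ// sabs_sofR. Qed.

Lemma seminormB_le V p x y z : subspace V -> seminorm_on V p ->
  V x -> V y -> V z -> p (x - z) <= p (x - y) + p (y - z).
Proof.
move=> sV sp Vx Vy Vz.
have -> : x - z = (x - y) + (y - z) by rewrite addrA subrK.
by apply: sp.2; apply: subspaceB.
Qed.

Global Instance snbhs_filter V P x : Filter (snbhs V P x).
Proof.
apply: filter_from_filter.
  exists (set0, 1) => /=; split => //; exact: finite_set0.
move=> [F e] [G d] /= [fF FP e0] [fG GP d0].
exists (F `|` G, Num.min e d) => /=.
  split; first by rewrite finite_setU.
  - by move=> p [/FP|/GP].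
  - by rewrite lt_min e0.
by move=> y [Vy h]; split; split=> // p Fp;
  [have := h p (or_introl Fp)|have := h p (or_intror Fp)];
  rewrite lt_min => /andP[].
Qed.

(** A basic neighbourhood involves finitely many seminorms and one radius, so its conditions can be
    intersected in the filter one after the other. From here on convergence is checked seminorm by
    seminorm. *)
Lemma cvg_snbhs V P (F : set_system E) x : Filter F ->
  F --> snbhs V P x <->
  F V /\ forall p, P p -> forall e : R, 0 < e -> F [set y | p (y - x) < e].
Proof.
move=> FF; split=> [h|[FV FP] U].
  split.
    apply: h; exists (set0, 1) => /=; last by move=> y [].
    by split=> //; exact: finite_set0.
  move=> p Pp e e0; apply: h; exists ([set p], e) => /=.
    by split=> // q ->.
  by move=> y /= [_ /(_ p erefl)].
move=> -[[G e] /= [fG GP e0] GU].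
have /finite_seqP[s Gs] := fG.
have FG : F [set y | forall p, p \in s -> p (y - x) < e].
  have : {subset s <= P} by move=> p ps; apply/mem_set/GP; rewrite Gs.
  elim: s {Gs} => [_|p s IH sP]; first exact: filterS filterT.
  have /IH Fs : {subset s <= P} by move=> q qs; apply: sP; rewrite inE qs orbT.
  have Fp : F [set y | p (y - x) < e].
    by apply: FP => //; apply/set_mem/sP; rewrite inE eqxx.
  by apply: filterS2 _ Fp Fs => y py sy q; rewrite inE => /predU1P[->//|/sy].
apply: filterS2 _ FV FG => y Vy yG; apply: GU; split=> // p.
by rewrite Gs => /yG.
Qed.

Lemma snbhs1P V q x U : snbhs V [set q] x U <->
  exists2 e : R, 0 < e & forall y, V y -> q (y - x) < e -> U y.
Proof.
split=> [[[G e] /= [fG GP e0] GU]|[e e0 eU]].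
  exists e => // y Vy qy; apply: GU; split=> // p /GP ->; exact: qy.
exists ([set q], e) => /=; first by split => //; exact: finite_set1.
by move=> y /= [Vy /(_ q erefl)]; exact: eU.
Qed.

Lemma snbhs_carrier V P x : snbhs V P x V.
Proof. by have /cvg_snbhs[] := @cvg_id _ (snbhs V P x). Qed.

Lemma snbhs_ball V P p x (e : R) : P p -> 0 < e ->
  snbhs V P x [set y | p (y - x) < e].
Proof.
move=> Pp e0.
by have /cvg_snbhs[_] := @cvg_id _ (snbhs V P x); apply.
Qed.

Lemma cvgP_snbhs V P (S : Type) (F : set_system S) (f : S -> E) x : Filter F ->
  f @ F --> snbhs V P x <->
  F [set s | V (f s)] /\
  forall p, P p -> forall e : R, 0 < e -> F [set s | p (f s - x) < e].
Proof. by move=> FF; apply: cvg_snbhs. Qed.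

Lemma cvg_snbhs_linear V P (S : Type) (F : set_system S) {FF : Filter F}
    (f g : S -> E) a x y : subspace V -> (forall p, P p -> seminorm_on V p) ->
  V x -> V y -> f @ F --> snbhs V P x -> g @ F --> snbhs V P y ->
  (fun s => a *: f s + g s) @ F --> snbhs V P (a *: x + y).
Proof.
move=> sV sP Vx Vy /cvgP_snbhs[fV fP] /cvgP_snbhs[gV gP].
apply/cvgP_snbhs; split.
  by apply: filterS2 _ fV gV => s /= Vf Vg; apply: subspaceD => //; exact: subspaceZ.
move=> p Pp e e0; have a0 := sabs_ge0 a; have a1 : 0 < sabs a + 1 by lra.
(* Adding 1 to [sabs a] keeps the denominator positive when [a = 0]. *)
have /= fe := fP p Pp (e / 2 / (sabs a + 1)) ltac:(by rewrite !divr_gt0).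
have /= ge := gP p Pp (e / 2) ltac:(by rewrite !divr_gt0).
apply: filterS2 _ (filterI fV fe) (filterI gV ge) => s /= [Vf pf] [Vg pg].
have -> : a *: f s + g s - (a *: x + y) = a *: (f s - x) + (g s - y).
  by rewrite opprD addrACA scalerBr.
have sp := sP p Pp.
have fxV := subspaceB sV Vf Vx; have gyV := subspaceB sV Vg Vy.
apply: (le_lt_trans (sp.2 _ _ (subspaceZ a sV fxV) gyV)).
rewrite sp.1// [e]splitr; apply: ler_ltD => //.
rewrite ltr_pdivlMr// in pf; apply: le_trans (ltW pf).
by rewrite mulrDr mulr1 mulrC lerDl; apply: (seminorm_ge0 sV sp).
Qed.

Lemma cvg_snbhs_unique V P (F : set_system E) {FF : ProperFilter F} x y :
  hausdorff_in V P -> V x -> V y ->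
  F --> snbhs V P x -> F --> snbhs V P y -> x = y.
Proof.
move=> hV Vx Vy Fx Fy; apply: contrapT => /(hV _ _ Vx Vy)[U [W [Ux Wy UW]]].
have : F (U `&` W) by apply: filterI; [exact: Fx|exact: Fy].
by rewrite UW => /filter_not_empty.
Qed.
End Seminorms.

(** * Neighbourhoods on the half-line and a one-sided mean value inequality *)

Section RightNeighbourhoods.
Context {R : realType}.
Implicit Types (Q : set R) (d t : R).

Lemma near_right0P Q : (\forall t \near 0^'+, Q t) <->
  exists2 d, 0 < d & forall t, 0 < t -> t < d -> Q t.
Proof.
split=> [/nbhs_ballP[d /= d0 dQ]|[d d0 dQ]].
  exists d => // t t0 td; apply: dQ => //=; rewrite /ball/= sub0r normrN gtr0_norm//.
apply/nbhs_ballP; exists d => //= t; rewrite /ball/= sub0r normrN => td t0.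
by apply: dQ => //; rewrite (le_lt_trans (ler_norm _) td).
Qed.

Lemma near_within_ge0P Q t :
  (\forall s \near within [set s : R | 0 <= s] (nbhs t), Q s) <->
  exists2 d, 0 < d & forall s, 0 <= s -> `|s - t| < d -> Q s.
Proof.
split=> [/nbhs_ballP[d /= d0 dQ]|[d d0 dQ]].
  by exists d => // s s0 sd; apply: dQ => //=; rewrite /ball/= distrC.
by apply/nbhs_ballP; exists d => //= s; rewrite /ball/= distrC => sd s0; exact: dQ.
Qed.

(** If [Q] failed arbitrarily close to 0, failures [s n < 1 / (n + 1)] could be chosen, and they
    would tend to [0^'+]. This makes properties stated for sequences available along the filter
    [0^'+]. *)
Lemma near_right0_seq Q d : 0 < d ->
  (forall s : nat -> R, (forall n, 0 < s n < d) -> s @ \oo --> 0^'+ ->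
    exists n, Q (s n)) -> \forall t \near 0^'+, Q t.
Proof.
move=> d0 hQ; apply: contrapT => nQ.
have /choice[s hs] : forall n : nat, exists s : R,
    0 < s < Num.min d n.+1%:R^-1 /\ ~ Q s.
  move=> n; apply: contrapT => H; apply: nQ; apply/near_right0P.
  exists (Num.min d n.+1%:R^-1) => [|t t0 td]; first by rewrite lt_min d0 invr_gt0/=.
  by apply: contrapT => Qt; apply: H; exists t; rewrite t0 td.
have [||n] := hQ s; last by case: (hs n).
  by move=> n; have [/andP[-> ]] := hs n; rewrite lt_min => /andP[->].
move=> U /near_right0P[e e0 eU]; have := near_infty_natSinv_lt (PosNum e0).
suff sub : [set n | n.+1%:R^-1 < e] `<=` s @^-1` U by apply: filterS.
move=> n /= ne; have [/andP[s0 ]] := hs n; rewrite lt_min => /andP[_ sn] _.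
by apply: eU => //; apply: lt_trans ne.
Qed.

(** The supremum [c] of the times of [[0, b]] at which [h t <= K * t] is itself such a time by lower
    semicontinuity; if [c < b], the bound on right increments would carry the estimate past [c]. *)
Lemma dini_le (h : R -> R) (b K : R) : 0 <= b -> 0 <= K -> h 0 <= 0 ->
  (forall t, 0 <= t <= b -> forall e, 0 < e ->
    \forall s \near within [set s : R | 0 <= s] (nbhs t), h t <= h s + e) ->
  (forall t, 0 <= t < b -> \forall s \near 0^'+, h (t + s) <= h t + K * s) ->
  h b <= K * b.
Proof.
move=> b0 K0 h0 hlsc hd; pose S := [set t | 0 <= t <= b /\ h t <= K * t].
have S0 : S 0 by rewrite /S/= lexx b0 mulr0.
have hS : has_sup S by split; [exists 0|exists b => t [/andP[]]].
pose c := sup S.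
have c0 : 0 <= c by apply: ub_le_sup => //; case: hS.
have cb : c <= b by apply: ge_sup; [exists 0|move=> t [/andP[]]].
have hc : h c <= K * c.
  apply/ler_addgt0Pr => e e0.
  have c0b : 0 <= c <= b by rewrite c0.
  have /near_within_ge0P[d d0 dh] := hlsc c c0b e e0.
  have [s [/andP[s0 sb] hs] cs] := sup_adherent d0 hS.
  have sc : s <= c by apply: ub_le_sup; [case: hS|split=> //; rewrite s0].
  rewrite -/c in cs; apply: (le_trans (dh s s0 _)).
    by rewrite ler0_norm; lra.
  by rewrite lerD2r (le_trans hs)// ler_wpM2l.
move: cb; rewrite le_eqVlt => /predU1P[<-//|cb].
have c0b : 0 <= c < b by rewrite c0.
have /near_right0P[d d0 dh] := hd c c0b.
pose s := Num.min (d / 2) ((b - c) / 2).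
have s0 : 0 < s by rewrite lt_min !divr_gt0// subr_gt0.
have sd : s < d by rewrite gt_min; apply/orP; left; lra.
have sb : s < b - c by rewrite gt_min; apply/orP; right; lra.
have : S (c + s).
  split; first by lra.
  by apply: (le_trans (dh s s0 sd)); rewrite mulrDr lerD2r.
by move=> /(ub_le_sup hS.2); rewrite -/c; lra.
Qed.
End RightNeighbourhoods.

(** * Bi-continuous semigroups and their generators *)
Section Norming.
Context {R : realType} {k : scalar_kind} {E : lmodType (base_field R k)}.
Variables (X : nspace E) (P : set (E -> R)).
Hypothesis hP : norming X P.

Lemma norming_le p x : P p -> carrier X x -> p x <= nrm X x.
Proof.
move=> Pp Xx; rewrite -lee_fin -(hP Xx).
by apply: ereal_sup_ubound; exists p.
Qed.

(** Norm estimates can thus be proved for one seminorm of [P] at a time, where the limits defining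
    the generator give information. *)
Lemma norming_le_nrm c x : carrier X x -> (forall p, P p -> p x <= c) ->
  nrm X x <= c.
Proof.
move=> Xx pc; rewrite -lee_fin -(hP Xx).
by apply: ge_ereal_sup => _ [p Pp <-]; rewrite lee_fin pc.
Qed.
End Norming.

Section Semigroup.
Context {R : realType} {k : scalar_kind} {E : lmodType (base_field R k)}.
Variables (X : nspace E) (P : set (E -> R)) (T : R -> E -> E).
Hypothesis hT : bicontinuous_semigroup X P T.
Implicit Types (x y z : E) (s t : R).

Let A := generator X P T.
Let hS := bs_assumption_S hT.

Let sX : subspace X. Proof. by case: (aS_banach hS). Qed.
Let nX : seminorm_on X (nrm X). Proof. by case: (aS_banach hS) => _ []. Qed.
Let TX t x : 0 <= t -> carrier X x -> carrier X (T t x).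
Proof. by move=> t0; case: (bs_bounded hT t0) => + _ _; exact. Qed.
Let TL t : 0 <= t -> linear_on X (T t).
Proof. by move=> t0; case: (bs_bounded hT t0). Qed.
Let TC s t x : 0 <= t -> 0 <= s -> carrier X x -> T s (T t x) = T t (T s x).
Proof. by move=> t0 s0 Xx; rewrite -!(bs_add hT)// addrC. Qed.

Lemma bounded_operator_ge0 t : 0 <= t ->
  exists2 C, 0 <= C & forall x, carrier X x -> nrm X (T t x) <= C * nrm X x.
Proof.
move=> t0; have [_ _ [C hC]] := bs_bounded hT t0; exists `|C| => // x Xx.
apply: (le_trans (hC x Xx)); apply: ler_wpM2r; last exact: ler_norm.
exact: seminorm_ge0 nX Xx.
Qed.

Lemma locally_bounded_semigroup (t0 : R) : exists2 K, 0 < K &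
  forall t x, 0 <= t <= t0 -> carrier X x -> nrm X (T t x) <= K * nrm X x.
Proof.
have [M [w [M1 hM]]] := bs_exp_bounded hT.
(* The absolute value makes the exponential nondecreasing in time whatever the sign of [w], so its
   value at [t0] bounds the earlier ones. *)
exists (M * expR (`|w| * t0)); first by rewrite mulr_gt0 ?expR_gt0//; lra.
move=> t x /andP[tge0 tt0] Xx; apply: (le_trans (hM t x tge0 Xx)).
apply: ler_wpM2r; first exact: seminorm_ge0 nX Xx.
apply: ler_wpM2l; first lra.
rewrite ler_expR; apply: (@le_trans _ _ (`|w| * t)).
  by apply: ler_wpM2r => //; exact: ler_norm.
by apply: ler_wpM2l.
Qed.

Lemma quotient_limit_unique x y z :
  quotient_limit X P T x y -> quotient_limit X P T x z -> y = z.
Proof.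
by move=> [Xy xy] [Xz xz]; apply: cvg_snbhs_unique (aS_hausdorff hS) Xy Xz xy xz.
Qed.

Lemma generatorP x : dom A x -> quotient_limit X P T x (A x).
Proof. by case=> _ xy _; exact: (@xgetPex _ 0 _ xy). Qed.

(** [xget] selects some limit of the difference quotients, and the Hausdorff property leaves only
    one. *)
Lemma generatorE x y : quotient_limit X P T x y -> A x = y.
Proof.
move=> xy; apply: (quotient_limit_unique _ xy).
exact: (@xgetPex _ 0 [set y | quotient_limit X P T x y] (ex_intro _ y xy)).
Qed.

Lemma generator_carrier x : dom A x -> carrier X x /\ carrier X (A x).
Proof. by move=> Ax; split; [case: Ax|case: (generatorP Ax)]. Qed.

Lemma generator_lipschitz x : dom A x -> exists2 L, 0 <= L &
  forall t, 0 < t <= 1 -> nrm X (T t x - x) <= L * t.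
Proof.
move=> [Xx _ [L hL]]; exists (Num.max 0 L); first by rewrite le_max lexx.
move=> t /andP[t0 t1]; rewrite -ler_pdivrMr// le_max; apply/orP; right.
by apply: hL; exists t => //=; rewrite in_itv/= t0.
Qed.

(* Equicontinuity only concerns sequences; along [0^'+] it is used through
   sequences. *)
Lemma semigroup_cvg_right0 t y (u : R -> E) C d : 0 <= t -> 0 < d ->
  (forall s, 0 < s < d -> carrier X (u s) /\ nrm X (u s) <= C) ->
  carrier X y -> u s @[s --> 0^'+] --> snbhs X P y ->
  T t (u s) @[s --> 0^'+] --> snbhs X P (T t y).
Proof.
move=> t0 d0 hu Xy uy; apply/cvgP_snbhs; split.
  apply/near_right0P; exists d => // s s0 sd; apply: TX => //.
  by apply: (hu s _).1; rewrite s0.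
move=> p Pp e e0; apply: (near_right0_seq d0) => s sd s0.
(* Equicontinuity speaks of bounded null sequences, so the limit is subtracted first. *)
pose v n := u (s n) - y.
have Xv n : carrier X (v n) by apply: subspaceB => //; exact: (hu _ (sd n)).1.
have vC : exists C0, forall n, nrm X (v n) <= C0.
  exists (C + nrm X y) => n; have [Xu uC] := hu _ (sd n).
  rewrite (le_trans (nX.2 _ _ Xu _))//; last by rewrite (seminormN nX)// lerD2r.
  by rewrite -scaleN1r; exact: subspaceZ.
have v0 : v @ \oo --> snbhs X P 0.
  apply/cvgP_snbhs; split; first exact: filterE.
  move=> q Pq r r0; have /cvgP_snbhs[_ /(_ q Pq r r0) h] := uy.
  have := s0 _ h; rewrite !nbhs_simpl /=; apply: filterS => n /=.
  by rewrite subr0.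
have [n hn] := filter_ex (bs_bi_equicontinuous hT Xv vC v0 t0 (snbhs_ball X 0 Pp e0)).
exists n; have := hn t; rewrite t0 lexx => /(_ isT) /=.
by rewrite subr0 /v (subspace_linearB sX (TL t0))//; exact: (hu _ (sd n)).1.
Qed.

(** [T t] is only known to preserve the convergence of norm-bounded families. The difference
    quotients of [z] are such a family, thanks to the norm bound in the definition of the domain. *)
Lemma generator_semigroup t z : 0 <= t -> dom A z ->
  dom A (T t z) /\ A (T t z) = T t (A z).
Proof.
move=> t0 Az; have [Xz XAz] := generator_carrier Az.
have [L L0 hL] := generator_lipschitz Az.
have Xd s : 0 <= s -> carrier X (T s z - z).
  by move=> s0; apply: subspaceB => //; exact: TX.
have dE s : 0 <= s -> T s (T t z) - T t z = T t (T s z - z).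
  by move=> s0; rewrite TC// (subspace_linearB sX (TL t0))//; exact: TX.
have hq : quotient_limit X P T (T t z) (T t (A z)).
  split; first exact: TX.
  have [_ zAz] := generatorP Az.
  have /semigroup_cvg_right0 : forall s, 0 < s < 1 ->
      carrier X ((sofR k s)^-1 *: (T s z - z)) /\
      nrm X ((sofR k s)^-1 *: (T s z - z)) <= L.
    move=> s /andP[s0 s1]; split; first by apply: subspaceZ => //; exact/Xd/ltW.
    rewrite sofRV (seminormZ_sofR _ nX); last exact/Xd/ltW.
    rewrite gtr0_norm ?invr_gt0// mulrC ler_pdivrMr// hL// s0; exact: ltW.
  move=> /(_ t (A z) t0 ltr01 XAz zAz).
  apply: cvg_trans; apply: near_eq_cvg; apply/near_right0P; exists 1 => // s s0 _.
  rewrite (dE _ (ltW s0)) (subspace_linearZ _ sX (TL t0))//; exact/Xd/ltW.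
split; last exact: generatorE.
split; [exact: TX|by exists (T t (A z))|].
have [C C0 hC] := bounded_operator_ge0 t0.
exists (C * L) => _ [s /= + <-]; rewrite in_itv/= => /andP[s0 s1].
rewrite ler_pdivrMr// (dE _ (ltW s0)); apply: (le_trans (hC _ (Xd s (ltW s0)))).
by rewrite -mulrA ler_wpM2l// hL// s0.
Qed.

Lemma generator_linear (a : base_field R k) x y : dom A x -> dom A y ->
  dom A (a *: x + y) /\ A (a *: x + y) = a *: A x + A y.
Proof.
move=> Ax Ay; have [Xx XAx] := generator_carrier Ax.
have [Xy XAy] := generator_carrier Ay.
have dE s : 0 <= s -> T s (a *: x + y) - (a *: x + y) =
    a *: (T s x - x) + (T s y - y).
  by move=> s0; rewrite (TL s0)// opprD addrACA scalerBr.
have Xd w s : 0 < s -> carrier X w -> carrier X (T s w - w).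
  by move=> /ltW s0 Xw; apply: subspaceB => //; exact: TX.
have hq : quotient_limit X P T (a *: x + y) (a *: A x + A y).
  split; first by apply: subspaceD => //; exact: subspaceZ.
  have := cvg_snbhs_linear (a := a) sX (aS_seminorms hS)
    XAx XAy (generatorP Ax).2 (generatorP Ay).2.
  move=> /(_ _).
  apply: cvg_trans; apply: near_eq_cvg; apply/near_right0P; exists 1 => // s s0 _.
  by rewrite (dE _ (ltW s0)) [RHS]scalerDr !scalerA mulrC.
split; last exact: generatorE.
split; first by apply: subspaceD => //; exact: subspaceZ.
  by exists (a *: A x + A y).
have [L L0 hL] := generator_lipschitz Ax.
have [M M0 hM] := generator_lipschitz Ay.
exists (sabs a * L + M) => _ [s /= + <-]; rewrite in_itv/= => s01.
have /andP[s0 s1] := s01.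
rewrite ler_pdivrMr// (dE _ (ltW s0)).
apply: (le_trans (nX.2 _ _ _ _)); try by [apply: Xd|apply: subspaceZ => //; apply: Xd].
rewrite nX.1 ?mulrDl; last exact: Xd.
by rewrite lerD ?hM// -mulrA ler_wpM2l ?sabs_ge0 ?hL.
Qed.

Lemma generator_subspace : subspace (dom A).
Proof.
split; last by move=> a x y Ax Ay; case: (generator_linear a Ax Ay).
have T0 s : 0 <= s -> T s 0 = 0 by move=> s0; exact: subspace_linear0 sX (TL s0).
have X0 : carrier X 0 by case: sX.
split=> //; last first.
  exists 0 => _ [s /= + <-]; rewrite in_itv/= => /andP[s0 s1].
  by rewrite (T0 _ (ltW s0)) subrr (seminorm0 sX nX) mul0r.
exists 0; split=> //; apply/cvgP_snbhs; split.
  apply/near_right0P; exists 1 => // s s0 _ /=.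
  by rewrite (T0 _ (ltW s0)) subrr scaler0.
move=> p Pp e e0; apply/near_right0P; exists 1 => // s s0 _ /=.
by rewrite (T0 _ (ltW s0)) subrr scaler0 subrr (seminorm0 sX (aS_seminorms hS Pp)).
Qed.

(* Applied with [A z] a vector of norm strong continuity, this makes the
   difference quotients of [z] converge in norm, which avoids integrating the
   orbit of [A z]. *)
Lemma generator_mean_value z t eps : norming X P -> dom A z ->
  0 <= t -> 0 <= eps ->
  (forall s, 0 <= s <= t -> nrm X (T s (A z) - A z) <= eps) ->
  nrm X (T t z - z - sofR k t *: A z) <= eps * t.
Proof.
move=> hP Az t0 eps0 heps; have [Xz XAz] := generator_carrier Az.
have XsA (s : R) : carrier X (sofR k s *: A z) by exact: subspaceZ.
have Xd s : 0 <= s -> carrier X (T s z - z - sofR k s *: A z).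
  by move=> s0; apply: subspaceB => //; apply: subspaceB => //; exact: TX.
apply: (norming_le_nrm hP); first exact: Xd.
move=> p Pp; apply/ler_addgt0Pr => e e0.
have sp := aS_seminorms hS Pp.
(* The right increments of [h] are controlled only up to a slack [dl], chosen so that the
   accumulated error [dl * t] is at most [e]; the added 1 covers [t = 0]. *)
pose dl := e / (t + 1); have dl0 : 0 < dl by rewrite divr_gt0//; lra.
have dlt : dl * t <= e.
  rewrite /dl -mulrAC ler_pdivrMr; last lra.
  by rewrite ler_wpM2l; lra.
pose h s := p (T s z - z - sofR k s *: A z).
suff : h t <= (eps + dl) * t by rewrite mulrDl /h; lra.
have pA := seminorm_ge0 sX sp XAz.
apply: dini_le => //.
- by lra.
- by rewrite /h (bs_id hT)// subrr sofR0 scale0r subrr (seminorm0 sX sp).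
(* Lower semicontinuity: passing from [r] to [s] costs at most [p (T r z - T s z)] plus [|s - r|]
   times [p (A z)], and each is kept below [d / 2]. *)
- move=> r /andP[r0 rt] d d0.
  have /cvgP_snbhs[_ /(_ p Pp (d / 2))] := bs_continuous hT Xz r0.
  rewrite divr_gt0// => /(_ isT)/near_within_ge0P[d1 d10 hd1].
  have d2 : 0 < d / 2 / (p (A z) + 1) by rewrite !divr_gt0//; lra.
  apply/near_within_ge0P; exists (Num.min d1 (d / 2 / (p (A z) + 1))).
    by rewrite lt_min d10.
  move=> s s0; rewrite lt_min => /andP[sd1 sd2]; have /= := hd1 s s0 sd1.
  move=> sr; rewrite ltr_pdivlMr in sd2; last lra.
  have XT : carrier X (T r z - T s z) by apply: subspaceB => //; exact: TX.
  have -> : h r = p ((T s z - z - sofR k s *: A z) +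
                     ((T r z - T s z) + sofR k (s - r) *: A z)).
    rewrite /h sofRB scalerBl; congr (p _).
    rewrite [X in _ = _ + X]addrC addrA [X in _ = X + _]addrA subrK.
    by rewrite [RHS]addrC !addrA subrK.
  apply: (le_trans (sp.2 _ _ (Xd s s0) (subspaceD sX XT (XsA _)))).
  rewrite lerD2l; apply: (le_trans (sp.2 _ _ XT (XsA _))).
  rewrite (seminormZ_sofR _ sp)// (seminorm_distC sX sp (TX r0 Xz) (TX s0 Xz)).
  by have := normr_ge0 (s - r); lra.
(* Right increments: with [y = T r z], the increment is [s] times the error of the quotient of [y]
   against [A y], of size at most [dl * s], plus [s] times [A y - A z = T r (A z) - A z], of size at
   most [eps * s]. *)
move=> r /andP[r0 rt].
have [Ay AyE] := generator_semigroup r0 Az; set y := T r z in Ay AyE.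
have [Xy XAy] := generator_carrier Ay.
have [_ /cvgP_snbhs[_ /(_ p Pp dl dl0)]] := generatorP Ay.
move=> /near_right0P[d d0 hd]; apply/near_right0P; exists d => // s s0 sd.
have /= hds := hd s s0 sd.
have Xs : carrier X (T s y - y) by apply: subspaceB => //; apply: TX => //; exact: ltW.
have Xq : carrier X ((sofR k s)^-1 *: (T s y - y) - A y).
  by apply: subspaceB => //; exact: subspaceZ.
have -> : h (r + s) = p ((T r z - z - sofR k r *: A z) +
    (sofR k s *: ((sofR k s)^-1 *: (T s y - y) - A y) +
     sofR k s *: (A y - A z))).
  have s1 : sofR k s != 0 by rewrite sofR_eq0 gt_eqF.
  rewrite /h [r + s]addrC (bs_add hT (ltW s0) r0 Xz) -/y.
  rewrite [in RHS]scalerBr scalerA divff// scale1r scalerBr.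
  rewrite sofRD scalerDl; congr (p _).
  rewrite [X in _ = _ + X]addrA subrK [RHS]addrC.
  by rewrite [RHS]addrAC opprD !addrA subrK addrAC.
have XAB : carrier X (A y - A z) by exact: subspaceB.
have XsAB : carrier X (sofR k s *: (A y - A z)) by exact: subspaceZ.
have Xsq := subspaceZ (sofR k s) sX Xq.
apply: (le_trans (sp.2 _ _ (Xd r r0) (subspaceD sX Xsq XsAB))).
rewrite lerD2l; apply: (le_trans (sp.2 _ _ Xsq XsAB)).
rewrite !(seminormZ_sofR _ sp)// gtr0_norm// mulrDl addrC.
rewrite lerD// mulrC; apply: ler_wpM2r; try exact: ltW.
rewrite AyE; apply: (le_trans (norming_le hP Pp _)).
  by apply: subspaceB => //; exact: TX.
by apply: heps; rewrite r0 ltW.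
Qed.
End Semigroup.

(** * The closure of the domain as the space of norm strong continuity *)

Section StrongContinuity.
Context {R : realType} {k : scalar_kind} {E : lmodType (base_field R k)}.
Variables (X : nspace E) (P : set (E -> R)) (T : R -> E -> E).
Hypothesis hT : bicontinuous_semigroup X P T.
Hypothesis hP : norming X P.
Implicit Types (x y z : E) (s t : R).

Let A := generator X P T.
Let hS := bs_assumption_S hT.

Let sX : subspace X. Proof. by case: (aS_banach hS). Qed.
Let nX : seminorm_on X (nrm X). Proof. by case: (aS_banach hS) => _ []. Qed.
Let TX t x : 0 <= t -> carrier X x -> carrier X (T t x).
Proof. by move=> t0; case: (bs_bounded hT t0) => + _ _; exact. Qed.
Let TL t : 0 <= t -> linear_on X (T t).
Proof. by move=> t0; case: (bs_bounded hT t0). Qed.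

(** Divide the estimate of [generator_mean_value] by [t]. The quotients lie in [dom A], which is a
    subspace invariant under the semigroup. This serves both the identification of the closure of
    [dom A] and the density of the domain of the square of [A]. *)
Lemma quotient_norm_approx z e : dom A z ->
  (forall d, 0 < d -> \forall s \near 0^'+, nrm X (T s (A z) - A z) < d) ->
  0 < e -> exists t, [/\ 0 < t, dom A ((sofR k t)^-1 *: (T t z - z)) &
    nrm X ((sofR k t)^-1 *: (T t z - z) - A z) < e].
Proof.
move=> Az hd e0; have e2 : 0 < e / 2 by rewrite divr_gt0.
have [Xz XAz] := generator_carrier Az.
have /near_right0P[d d0 {}hd] := hd _ e2.
exists (d / 2); have t0 : 0 < d / 2 by rewrite divr_gt0.
have sA := generator_subspace hT.
have Ad : dom A (T (d / 2) z - z).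
  by apply: subspaceB => //; case: (generator_semigroup hT (ltW t0) Az).
split=> //; first exact: subspaceZ.
have := generator_mean_value hT hP Az (ltW t0) (ltW e2).
have XA0 : carrier X (T (d / 2) z - z) by case: (generator_carrier Ad).
have XsA : carrier X (sofR k (d / 2) *: A z) by exact: subspaceZ.
have -> : T (d / 2) z - z - sofR k (d / 2) *: A z =
    sofR k (d / 2) *: ((sofR k (d / 2))^-1 *: (T (d / 2) z - z) - A z).
  by rewrite scalerBr scalerA divff ?scale1r// sofR_eq0 gt_eqF.
rewrite (seminormZ_sofR _ nX); last first.
  by apply: subspaceB => //; exact: subspaceZ.
rewrite gtr0_norm// [_ * (d / 2)]mulrC ler_pM2l// => h.
apply: (@le_lt_trans _ _ (e / 2)); last lra.
(* The smallness near [0^'+] concerns [s > 0] only; at [s = 0] the difference vanishes. *)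
apply: h => s /andP[]; rewrite le_eqVlt => /predU1P[<- _|s0 sd].
  by rewrite (bs_id hT)// subrr (seminorm0 sX nX) ltW.
by apply/ltW/hd => //; lra.
Qed.

Lemma generator_right_continuous z d : dom A z -> 0 < d ->
  \forall s \near 0^'+, nrm X (T s z - z) < d.
Proof.
move=> Az d0; have [L L0 hL] := generator_lipschitz Az.
apply/near_right0P; exists (Num.min 1 (d / (L + 1))).
  by rewrite lt_min ltr01 divr_gt0//; lra.
move=> s s0; rewrite lt_min => /andP[s1]; rewrite ltr_pdivlMr; last lra.
have : 0 < s <= 1 by rewrite s0 ltW.
by move=> /hL; lra.
Qed.

(** Write [z = A w]. The orbit of [z] is right continuous at 0 because [z] is in [dom A], so the
    quotients of [w] approach [z] in norm; [A] sends them to the quotients of [z], which are again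
    in [dom A]. *)
Lemma generator_square_dense z e : dom A z -> 0 < e -> set_bij (dom A) X A ->
  exists v, [/\ dom A v, dom A (A v) & nrm X (v - z) < e].
Proof.
move=> Az e0 [_ _ surA]; have [Xz XAz] := generator_carrier Az.
have [w Aw wz] := surA _ Xz.
have [|t [t0 At ht]] := quotient_norm_approx Aw _ e0.
  by rewrite wz => d; exact: generator_right_continuous.
rewrite wz in ht; exists ((sofR k t)^-1 *: (T t w - w)); split=> //.
have sA := generator_subspace hT.
have lA : linear_on (dom A) A by move=> a x y Ax Ay; case: (generator_linear hT a Ax Ay).
have [Atw AtwE] := generator_semigroup hT (ltW t0) Aw.
have Atz : dom A (T t z) by case: (generator_semigroup hT (ltW t0) Az).
rewrite (subspace_linearZ _ sA lA) ?(subspace_linearB sA lA)//; last exact: subspaceB.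
by rewrite AtwE wz; apply: subspaceZ => //; exact: subspaceB.
Qed.

Lemma norm_cvg_semigroup x t : 0 <= t -> carrier X x ->
  (fun s => T s x) @ within [set s : R | 0 <= s] (nbhs t)
    --> snbhs X [set nrm X] (T t x) <->
  forall e, 0 < e -> exists2 d, 0 < d & forall s, 0 <= s -> `|s - t| < d ->
    nrm X (T s x - T t x) < e.
Proof.
move=> t0 Xx; split=> [/cvgP_snbhs[_ h] e e0|h].
  by have /near_within_ge0P := h _ erefl e e0.
apply/cvgP_snbhs; split.
  by apply/near_within_ge0P; exists 1 => // s s0 _; exact: TX.
by move=> _ -> e e0; apply/near_within_ge0P; exact: h.
Qed.

Lemma closure_generator_strongly_continuous x :
  closure_in X [set nrm X] (dom A) x ->
  carrier X x /\ strongly_continuous_at X [set nrm X] T x.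
Proof.
move=> [Xx cx]; split=> // t t0; apply/norm_cvg_semigroup => // e e0.
(* Times with [|s - t| < 1] stay in [[0, t + 1]], where one constant [K] serves. The triangle
   inequality through [T s y] and [T t y], with [y] in [dom A] near [x], then has three terms of
   size [e / 3]. *)
have [K K0 hK] := locally_bounded_semigroup hT (t + 1).
have e3 : 0 < e / (K * 3) by rewrite divr_gt0// mulr_gt0.
have [y [Ay /= yx]] := cx _ (snbhs_ball X x (erefl : [set nrm X] (nrm X)) e3).
have [Xy _] := generator_carrier Ay.
have [L L0 hL] := generator_lipschitz Ay.
have e4 : 0 < e / (K * 3 * (L + 1)) by rewrite divr_gt0// !mulr_gt0//; lra.
have XT r : 0 <= r -> carrier X (T r x) /\ carrier X (T r y).
  by move=> r0; split; exact: TX.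
have Kyx r : 0 <= r <= t + 1 -> nrm X (T r y - T r x) < e / 3.
  move=> r0t; have /andP[r0 _] := r0t.
  have -> : T r y - T r x = T r (y - x) by rewrite (subspace_linearB sX (TL r0)).
  apply: (le_lt_trans (hK r _ r0t (subspaceB sX Xy Xx))).
  move: yx; rewrite !ltr_pdivlMr ?mulr_gt0//; lra.
(* The increment equals [T r (T h y - y)], so the Lipschitz bound at time 0 spreads to later times
   with the factor [K]. *)
have inc r h : 0 <= r <= t + 1 -> 0 <= h <= 1 ->
    nrm X (T (r + h) y - T r y) <= K * (L * h).
  move=> r0t /andP[h0 h1]; have /andP[r0 _] := r0t.
  rewrite (bs_add hT r0 h0 Xy) -(subspace_linearB sX (TL r0))//; last exact: TX.
  apply: (le_trans (hK r _ r0t _)); first by apply: subspaceB => //; exact: TX.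
  apply: ler_wpM2l; first exact: ltW.
  move: h0; rewrite le_eqVlt => /predU1P[<-|h0]; last by rewrite hL// h0.
  by rewrite (bs_id hT)// subrr (seminorm0 sX nX) mulr0.
exists (Num.min 1 (e / (K * 3 * (L + 1)))); first by rewrite lt_min ltr01.
move=> s s0; rewrite lt_min => /andP[st1].
rewrite ltr_pdivlMr ?mulr_gt0//; last lra.
move=> ste; have := ler_norm (s - t) => sts.
have st : 0 <= s <= t + 1 by rewrite s0; lra.
have tt : 0 <= t <= t + 1 by lra.
have yst : nrm X (T s y - T t y) < e / 3.
  have : nrm X (T s y - T t y) <= K * (L * `|s - t|).
    have [le_st|/ltW le_ts] := leP s t.
      rewrite (seminorm_distC sX nX (XT s s0).2 (XT t t0).2) distrC.
      rewrite -{1}(subrKC s t); rewrite ger0_norm ?subr_ge0//; apply: inc => //.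
      rewrite subr_ge0 le_st; move: st1; rewrite distrC => st1.
      by have := ler_norm (t - s); lra.
    rewrite -{1}(subrKC t s) ger0_norm ?subr_ge0//; apply: inc => //.
    by rewrite subr_ge0 le_ts; lra.
  move=> /le_lt_trans; apply; rewrite ltr_pdivlMr//.
  by apply: le_lt_trans ste; have := mulr_ge0 (ltW K0) (normr_ge0 (s - t)); lra.
have /= := Kyx s st; have := Kyx t tt.
rewrite [X in _ -> X < _ -> _](seminorm_distC sX nX (XT s s0).2 (XT s s0).1).
have := seminormB_le sX nX (XT s s0).1 (XT s s0).2 (XT t t0).1.
have := seminormB_le sX nX (XT s s0).2 (XT t t0).2 (XT t t0).1.
lra.
Qed.

(** For the harder inclusion, surjectivity of [A] supplies [z] with [A z = x], and the norm
    continuity of the orbit of [x] at 0 is what [quotient_norm_approx] asks of [z]. *)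
Theorem strong_continuity_space : set_bij (dom A) X A ->
  closure_in X [set nrm X] (dom A) =
  [set x | carrier X x /\ strongly_continuous_at X [set nrm X] T x].
Proof.
move=> [_ _ surA]; apply/seteqP; split.
  exact: closure_generator_strongly_continuous.
move=> x [Xx cx]; split=> // U /snbhs1P[e e0 eU].
have [z Az zx] := surA _ Xx.
have [|t [t0 At ht]] := quotient_norm_approx Az _ e0.
  move=> d d0; rewrite zx.
  have [r r0 hr] := iffLR (norm_cvg_semigroup (lexx 0) Xx) (cx 0 (lexx 0)) d d0.
  apply/near_right0P; exists r => // s s0 sr.
  have := hr s (ltW s0); rewrite (bs_id hT)// subr0 gtr0_norm//; exact.
exists ((sofR k t)^-1 *: (T t z - z)); split=> //; apply: eU.
  by case: (generator_carrier At).
by rewrite -zx.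
Qed.
End StrongContinuity.

(** * Transport along isometric isomorphisms *)
Section Transport.
Context {R : realType} {k : scalar_kind} {E : lmodType (base_field R k)}.
Implicit Types (X Y : nspace E) (P Q : set (E -> R)) (T S : R -> E -> E).
Implicit Types (f g : E -> E).

(** The inverse [g] is explicit because all maps live on [E] and matter on carriers only. That [Y]
    is a subspace and [g] linear and isometric is derived in [isometry_sym]. *)
Record isometry X Y f g : Prop := Isometry {
  iso_subspace : subspace X ;
  iso_fun : forall x, carrier X x -> carrier Y (f x) ;
  iso_inv : forall y, carrier Y y -> carrier X (g y) ;
  iso_funK : forall x, carrier X x -> g (f x) = x ;
  iso_invK : forall y, carrier Y y -> f (g y) = y ;
  iso_linear : linear_on X f ;
  iso_nrm : forall x, carrier X x -> nrm Y (f x) = nrm X x }.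

Lemma isometry_sym X Y f g : isometry X Y f g -> isometry Y X g f.
Proof.
move=> [sX fXY gYX fK gK lf nf].
have lg : linear_on Y g.
  move=> a x y Yx Yy; rewrite -[in LHS](gK x)// -[in LHS](gK y)// -lf; last 2 first.
  - exact: gYX.
  - exact: gYX.
  by rewrite fK//; apply: subspaceD => //; [apply: subspaceZ => //|]; exact: gYX.
split=> //; last by move=> y Yy; rewrite -{2}(gK y Yy) nf//; exact: gYX.
split.
  rewrite -(subspace_linear0 sX lf); apply: fXY; by case: sX.
move=> a x y Yx Yy; rewrite -(gK x)// -(gK y)// -lf; try exact: gYX.
by apply: fXY; apply: subspaceD => //; [apply: subspaceZ => //|]; exact: gYX.
Qed.

(** Seminorms have arbitrary values off the carrier, so the families are put in correspondence on
    [X] instead of being equated. For an isometry [f], this makes [f] a homeomorphism. *)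
Definition matched X P Q f :=
  (forall p, P p -> exists2 q, Q q & forall x, carrier X x -> q (f x) = p x) /\
  (forall q, Q q -> exists2 p, P p & forall x, carrier X x -> q (f x) = p x).

Lemma matched_sym X Y P Q f g : isometry X Y f g ->
  matched X P Q f -> matched Y Q P g.
Proof.
move=> [_ _ gYX _ gK _ _] [PQ QP]; split=> [q /QP[p Pp qp]|p /PQ[q Qq qp]].
  by exists p => // y Yy; rewrite -qp ?gK//; exact: gYX.
by exists q => // y Yy; rewrite -qp ?gK//; exact: gYX.
Qed.

Lemma matched_nrm X Y f g : isometry X Y f g ->
  matched X [set nrm X] [set nrm Y] f.
Proof.
move=> [_ _ _ _ _ _ nf].
by split=> _ ->; [exists (nrm Y)|exists (nrm X)].
Qed.

Lemma matched_comp X Y P f g : isometry X Y f g ->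
  matched X P [set (fun y => p (g y)) | p in P] f.
Proof.
move=> [_ _ _ fK _ _ _]; split=> [p Pp|_ [p Pp <-]].
  by exists (fun y => p (g y)); [exists p|move=> x Xx; rewrite fK].
by exists p => // x Xx; rewrite fK.
Qed.

Section Isometry.
Variables (X Y : nspace E) (f g : E -> E) (P Q : set (E -> R)).
Hypotheses (fg : isometry X Y f g) (PQ : matched X P Q f).

Let sX := iso_subspace fg.
Let lf := iso_linear fg.

Lemma transport_cvg (U : Type) (F : set_system U) {FF : Filter F} (u : U -> E) x :
  carrier X x -> u @ F --> snbhs X P x ->
  (fun s => f (u s)) @ F --> snbhs Y Q (f x).
Proof.
move=> Xx /cvgP_snbhs[uX uP]; apply/cvgP_snbhs; split.
  by move: uX; apply: filterS => s /= ?; exact: (iso_fun fg).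
move=> q /PQ.2[p Pp qp] e e0; apply: filterS2 _ uX (uP p Pp e e0) => s /= Xu.
rewrite -(subspace_linearB sX lf)// qp//; exact: subspaceB.
Qed.

(** This is [transport_cvg] for the identity along the neighbourhood filter of [x]. *)
Lemma transport_nbhs x (U : set E) : carrier X x -> snbhs Y Q (f x) U ->
  snbhs X P x (f @^-1` U).
Proof.
move=> Xx; exact: (@transport_cvg _ (snbhs X P x) _ id x Xx (@cvg_id _ _) U).
Qed.

Lemma transport_cauchy (u : nat -> E) : (forall n, carrier X (u n)) ->
  cauchy_in X P u -> cauchy_in Y Q (fun n => f (u n)).
Proof.
move=> Xu cu U YU; have X0 : carrier X 0 by case: sX.
have [|n hn] := cu (f @^-1` U).
  by apply: transport_nbhs => //; rewrite (subspace_linear0 sX lf).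
by exists n => i j ni nj; rewrite -(subspace_linearB sX lf)//; exact: hn.
Qed.

Lemma transport_dual phi : dual_unit_ball Y Q phi ->
  dual_unit_ball X P (fun x => phi (f x)).
Proof.
move=> [lphi cphi nphi]; split.
- by move=> a x y Xx Xy; rewrite lf// lphi//; exact: (iso_fun fg).
- move=> x Xx e e0.
  exact: (transport_nbhs Xx (cphi _ (iso_fun fg Xx) e e0)).
- by move=> x Xx; rewrite -(iso_nrm fg Xx); exact/nphi/(iso_fun fg).
Qed.

Lemma transport_strongly_continuous T S x :
  (forall t y, 0 <= t -> carrier X y -> carrier X (T t y)) ->
  (forall t y, 0 <= t -> carrier X y -> S t (f y) = f (T t y)) ->
  carrier X x -> strongly_continuous_at X P T x ->
  strongly_continuous_at Y Q S (f x).
Proof.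
move=> TX TS Xx cx t t0; rewrite TS//.
have := transport_cvg (TX _ _ t0 Xx) (cx t t0) => /(_ _).
apply: cvg_trans; apply: near_eq_cvg; apply/near_within_ge0P; exists 1 => // s s0 _.
by rewrite TS.
Qed.

Lemma transport_quotient_limit T S x y :
  (forall t y, 0 <= t -> carrier X y -> carrier X (T t y)) ->
  (forall t y, 0 <= t -> carrier X y -> S t (f y) = f (T t y)) ->
  carrier X x -> quotient_limit X P T x y ->
  quotient_limit Y Q S (f x) (f y).
Proof.
move=> TX TS Xx [Xy cx]; split; first exact: (iso_fun fg).
have := transport_cvg Xy cx => /(_ _).
apply: cvg_trans; apply: near_eq_cvg; apply/near_right0P; exists 1 => // s s0 _.
have XT := TX _ _ (ltW s0) Xx.
rewrite TS ?ltW// -(subspace_linearB sX lf)// (subspace_linearZ _ sX lf)//.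
exact: subspaceB.
Qed.
End Isometry.

(** A Cauchy sequence is pulled back by [g] and its limit pushed forward by [f]. General sets [D]
    and [D'] cover both the whole space with its norm and the unit ball with the coarser
    topology. *)
Lemma transport_seq_complete X Y f g P Q (D D' : set E) : isometry X Y f g ->
  matched X P Q f -> D' `<=` Y -> (forall y, D' y -> D (g y)) ->
  (forall x, D x -> carrier X x /\ D' (f x)) ->
  seq_complete_on X P D -> seq_complete_on Y Q D'.
Proof.
move=> fg PQ D'Y gD fD cD u D'u cu; have gf := isometry_sym fg.
have Yu n : carrier Y (u n) by exact: D'Y.
have [x [Dx ux]] := cD (fun n => g (u n)) (fun n => gD _ (D'u n))
  (transport_cauchy gf (matched_sym fg PQ) Yu cu).
have [Xx D'x] := fD _ Dx; exists (f x); split=> //.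
have := transport_cvg fg PQ Xx ux => /(_ _).
by under eq_fun do rewrite (iso_invK fg)//.
Qed.

Lemma transport_assumption_S X Y f g P Q : isometry X Y f g ->
  matched X P Q f -> assumption_S X P -> assumption_S Y Q.
Proof.
move=> fg PQ [[sX [nX nX0] cX] sP hX cP uX dX]; have gf := isometry_sym fg.
have QP := matched_sym fg PQ.
have sY := iso_subspace gf; have lg := iso_linear gf.
have semi p q : (forall x, carrier X x -> q (f x) = p x) ->
    seminorm_on X p -> seminorm_on Y q.
  move=> qp [pZ pD].
  have qg y : carrier Y y -> q y = p (g y).
    by move=> Yy; rewrite -qp ?(iso_invK fg)//; exact: (iso_inv fg).
  split=> [a y Yy|x y Yx Yy].
    rewrite !qg//; last exact: subspaceZ.
    by rewrite (subspace_linearZ _ sY lg)// pZ//; exact: (iso_inv fg).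
  rewrite !qg//; last exact: subspaceD.
  by rewrite (subspace_linearD sY lg)// pD//; exact: (iso_inv fg).
split.
- split=> //; last first.
    apply: (transport_seq_complete fg (matched_nrm fg) _ (iso_inv fg) _ cX) => //.
    by move=> x Xx; split=> //; exact: (iso_fun fg).
  split; first exact: (semi (nrm X) _ (iso_nrm fg)).
  move=> y Yy y0; rewrite -(iso_invK fg Yy).
  rewrite (nX0 (g y) (iso_inv fg Yy)) ?(subspace_linear0 sX (iso_linear fg))//.
  by rewrite (iso_nrm gf).
- by move=> q /PQ.2[p /sP sp qp]; exact: semi sp.
- move=> x y Yx Yy xy.
  have [|U [W [Ux Wy UW]]] := hX (g x) (g y) (iso_inv fg Yx) (iso_inv fg Yy).
    by move=> gxy; apply: xy; rewrite -(iso_invK fg Yx) gxy (iso_invK fg Yy).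
  exists (g @^-1` U), (g @^-1` W); split; try exact: (transport_nbhs gf QP).
  by rewrite -preimage_setI UW preimage_set0.
(* The neighbourhood is pulled back to [X], compared there with the norm topology, and brought back
   to [Y]. Since [f (g z) = z] holds on [Y] only, the result is intersected with the carrier. *)
- move=> y Yy U YU.
  rewrite -(iso_invK fg Yy) in YU.
  have /cP/(transport_nbhs gf (matched_nrm gf) Yy) :=
    transport_nbhs fg PQ (iso_inv fg Yy) YU.
  move=> /(_ (iso_inv fg Yy)) h.
  apply: filterS2 _ h (snbhs_carrier Y _ y) => z /= Uz Yz.
  by rewrite (iso_invK fg Yz) in Uz.
- apply: (transport_seq_complete fg PQ _ _ _ uX).
  + by move=> y [].
  + by move=> y [Yy y1]; split; [exact: (iso_inv fg)|rewrite (iso_nrm gf)].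
  + move=> x [Xx x1]; split=> //; split; first exact: (iso_fun fg).
    by rewrite (iso_nrm fg).
(* Composition with [f] and with [g] exchanges the two dual unit balls, so both suprema run over the
   same set of values. *)
- move=> y Yy; rewrite -(iso_nrm gf Yy) -(dX _ (iso_inv fg Yy)).
  congr ereal_sup; apply/seteqP; split=> _ [phi phiB <-].
    exists (fun x => phi (f x)); first exact: (transport_dual fg PQ).
    by rewrite (iso_invK fg Yy).
  by exists (fun x => phi (g x)); first exact: (transport_dual gf QP).
Qed.

(** * Transport of semigroups, generators and spaces of strong continuity *)

Section Semigroup.
Variables (X Y : nspace E) (f g : E -> E) (P Q : set (E -> R)).
Variables (T S : R -> E -> E).
Hypotheses (fg : isometry X Y f g) (PQ : matched X P Q f).
Hypothesis hT : bicontinuous_semigroup X P T.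
Hypothesis TS : forall t x, 0 <= t -> carrier X x -> S t (f x) = f (T t x).

Let gf := isometry_sym fg.
Let QP := matched_sym fg PQ.

Let TX t x : 0 <= t -> carrier X x -> carrier X (T t x).
Proof. by move=> t0; case: (bs_bounded hT t0) => + _ _; exact. Qed.

Let SE t y : 0 <= t -> carrier Y y -> S t y = f (T t (g y)).
Proof.
by move=> t0 Yy; rewrite -TS// ?(iso_invK fg)//; exact: (iso_inv fg).
Qed.

Let SY t y : 0 <= t -> carrier Y y -> carrier Y (S t y).
Proof.
by move=> t0 Yy; rewrite SE//; apply/(iso_fun fg)/TX => //; exact: (iso_inv fg).
Qed.

Let ST t y : 0 <= t -> carrier Y y -> T t (g y) = g (S t y).
Proof.
move=> t0 Yy; rewrite SE// (iso_funK fg)//; apply: TX => //; exact: (iso_inv fg).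
Qed.

Lemma transport_semigroup : bicontinuous_semigroup Y Q S.
Proof.
have gY := iso_inv fg; have fX := iso_fun fg.
split.
- exact: transport_assumption_S fg PQ (bs_assumption_S hT).
- move=> t t0; have [_ lT [C hC]] := bs_bounded hT t0; split.
  + by move=> y; exact: SY.
  + move=> a x y Yx Yy; have sY := iso_subspace gf.
    rewrite !SE//; last by apply: subspaceD => //; exact: subspaceZ.
    by rewrite (iso_linear gf)// lT ?(iso_linear fg)//; try apply: TX => //;
      exact: gY.
  + exists C => y Yy; rewrite SE// (iso_nrm fg) -?(iso_nrm gf Yy).
      exact/hC/gY.
    exact/TX/gY.
- by move=> y Yy; rewrite SE// (bs_id hT) ?(iso_invK fg)//; exact: gY.
- move=> t s y t0 s0 Yy; rewrite SE ?addr_ge0// (SE t0 (SY s0 Yy)) -ST//.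
  by rewrite (bs_add hT)//; exact: gY.
- move=> y Yy; rewrite -(iso_invK fg Yy).
  apply: (transport_strongly_continuous fg PQ TX TS (gY _ Yy)).
  exact/(bs_continuous hT)/gY.
- have [M [w [M1 hM]]] := bs_exp_bounded hT.
  exists M, w; split=> // t y t0 Yy; rewrite SE// (iso_nrm fg) -?(iso_nrm gf Yy).
    exact/hM/gY.
  exact/TX/gY.
- move=> u Yu [C uC] u0 t0 t00 U YU.
  have sX := iso_subspace fg; have sY := iso_subspace gf.
  have g0 := subspace_linear0 sY (iso_linear gf).
  have f0 := subspace_linear0 sX (iso_linear fg).
  have X0 : carrier X 0 by case: sX.
  have Y0 : carrier Y 0 by case: sY.
  have gu0 : g (u n) @[n --> \oo] --> snbhs X P 0.
    by have := transport_cvg gf QP Y0 u0 => /(_ _); rewrite g0.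
  have fU : snbhs X P 0 (f @^-1` U).
    by apply: (transport_nbhs fg PQ) => //; rewrite f0.
  have guC : exists C, forall n, nrm X (g (u n)) <= C.
    by exists C => n; rewrite (iso_nrm gf).
  have := bs_bi_equicontinuous hT (fun n => gY _ (Yu n)) guC gu0 t00 fU.
  apply: filterS => n hn s st; have /andP[s0 _] := st; rewrite SE//.
  exact: hn.
Qed.

(** The limit of the quotients is carried by the matched topologies and the norm bound by the
    isometry; one direction uses [g], the other [f]. *)
Lemma transport_generator y : dom (generator Y Q S) y <->
  carrier Y y /\ dom (generator X P T) (g y).
Proof.
split=> [[Yy [z yz] [C hC]]|[Yy [Xy [x gx] [C hC]]]]; split=> //.
- split; first exact: (iso_inv fg).
    by exists (g z); exact: (transport_quotient_limit gf QP SY ST Yy yz).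
  exists C => _ [t t01 <-]; move: (t01) => /=; rewrite in_itv/= => /andP[t0 t1].
  rewrite (ST (ltW t0) Yy) -(subspace_linearB (iso_subspace gf) (iso_linear gf))//.
    rewrite (iso_nrm gf); first by apply: hC; exists t.
    by apply: (subspaceB (iso_subspace gf)) => //; apply: SY => //; exact: ltW.
  by apply: SY => //; exact: ltW.
- exists (f x); rewrite -(iso_invK fg Yy).
  exact: (transport_quotient_limit fg PQ TX TS Xy gx).
- exists C => _ [t t01 <-]; move: (t01) => /=; rewrite in_itv/= => /andP[t0 t1].
  have XT : carrier X (T t (g y)) by apply: TX => //; exact: ltW.
  rewrite (SE (ltW t0) Yy) -{2}(iso_invK fg Yy).
  rewrite -(subspace_linearB (iso_subspace fg) (iso_linear fg))//.
  rewrite (iso_nrm fg); last exact: (subspaceB (iso_subspace fg)).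
  by apply: hC; exists t.
Qed.

Lemma transport_generatorE y : dom (generator Y Q S) y ->
  generator Y Q S y = f (generator X P T (g y)).
Proof.
move=> /transport_generator[Yy Ay]; apply: (generatorE transport_semigroup).
have [Xy _] := generator_carrier Ay.
rewrite -{1}(iso_invK fg Yy).
exact: (transport_quotient_limit fg PQ TX TS Xy (generatorP Ay)).
Qed.

(** The norm topology comes from the single seminorm [nrm], so the transport of strong continuity
    applies with [matched_nrm]. *)
Lemma transport_strong_continuity_space :
  [set y | carrier Y y /\ strongly_continuous_at Y [set nrm Y] S y] =
  f @` [set x | carrier X x /\ strongly_continuous_at X [set nrm X] T x].
Proof.
apply/seteqP; split=> [y [Yy cy]|_ [x [Xx cx] <-]].
  exists (g y); last exact: (iso_invK fg Yy).
  split; first exact: (iso_inv fg).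
  exact: (transport_strongly_continuous gf (matched_nrm gf) SY ST Yy).
split; first exact: (iso_fun fg).
exact: (transport_strongly_continuous fg (matched_nrm fg) TX TS Xx).
Qed.
End Semigroup.
End Transport.

(** * Extension of isometries *)
Section NormedExtension.
Context {R : realType} {k : scalar_kind} {E : lmodType (base_field R k)}.
Implicit Types (X Y Z : nspace E) (V D : set E) (q : E -> R) (f g : E -> E).

Lemma inverse_onK D f x : {in D &, injective f} -> D x ->
  inverse_on D f (f x) = x.
Proof. by move=> fI Dx; exact: (@pinvKV _ _ (fun=> 0) D f fI x (mem_set Dx)). Qed.

Lemma norm_hausdorff V q : subspace V -> norm_on V q ->
  hausdorff_in V [set q].
Proof.
move=> sV [sq q0] x y Vx Vy xy; have Vxy := subspaceB sV Vx Vy.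
pose r := q (x - y) / 2; have r0 : 0 < r.
  rewrite divr_gt0// lt_neqAle (seminorm_ge0 sV sq Vxy) andbT eq_sym.
  by apply/eqP => /(q0 _ Vxy)/eqP; rewrite subr_eq0 => /eqP.
exists (V `&` [set z | q (z - x) < r]), (V `&` [set z | q (z - y) < r]).
split; try by apply: filterI; [exact: snbhs_carrier|exact: snbhs_ball].
rewrite -subset0 => z [[Vz /= zx] [_ /= zy]].
have := seminormB_le sV sq Vx Vz Vy; rewrite (seminorm_distC sV sq Vx Vz).
by rewrite /r in zx zy; lra.
Qed.

(** A single seminorm gives a countable base of balls of radius [1 / (n + 1)]. *)
Lemma closure_in_seqP V D q x : D `<=` V -> closure_in V [set q] D x <->
  V x /\ exists2 d : nat -> E, forall n, D (d n) & d @ \oo --> snbhs V [set q] x.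
Proof.
move=> DV; split=> [[Vx cx]|[Vx [d Dd dx]]]; last first.
  split=> // U /dx dU; have [n Un] := filter_ex (dU : \forall n \near \oo, U (d n)).
  by exists (d n).
split=> //; have /choice[d hd] : forall n : nat, exists y, D y /\ q (y - x) < n.+1%:R^-1.
  move=> n; have [|y [Dy qy]] := cx [set y | q (y - x) < n.+1%:R^-1].
    by apply: snbhs_ball => //; rewrite invr_gt0.
  by exists y.
exists d => [n|]; first by case: (hd n).
apply/cvgP_snbhs; split; first by apply: filterE => n; apply: DV; case: (hd n).
move=> _ -> e e0; apply: filterS (near_infty_natSinv_lt (PosNum e0)) => n /= ne.
by apply: lt_trans ne; case: (hd n).
Qed.

Lemma closure_in_subset V D q : subspace V -> seminorm_on V q -> D `<=` V ->
  D `<=` closure_in V [set q] D.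
Proof.
move=> sV sq DV x Dx; split=> [|U /snbhs1P[e e0 eU]]; first exact: DV.
exists x; split=> //; apply: eU; first exact: DV.
by rewrite subrr (seminorm0 sV sq).
Qed.

Lemma closure_in_subspace V D q : subspace V -> seminorm_on V q -> D `<=` V ->
  subspace D -> subspace (closure_in V [set q] D).
Proof.
move=> sV sq DV sD; split.
  by apply: closure_in_subset sV sq DV _ _; case: sD.
move=> a x y /(closure_in_seqP _ _ DV)[Vx [c Dc cx]].
move=> /(closure_in_seqP _ _ DV)[Vy [d Dd dy]].
apply/(closure_in_seqP _ _ DV); split.
  by apply: subspaceD => //; exact: subspaceZ.
exists (fun n => a *: c n + d n).
  by move=> n; apply: subspaceD => //; exact: subspaceZ.
by apply: cvg_snbhs_linear => // _ ->.
Qed.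

Lemma cauchy_in_normP V q (u : nat -> E) : (forall n, V (u n)) -> subspace V ->
  cauchy_in V [set q] u <-> forall e, 0 < e -> exists n0 : nat,
    forall m n : nat, (n0 <= m)%N -> (n0 <= n)%N -> q (u m - u n) < e.
Proof.
move=> Vu sV; split=> [cu e e0|cu U /snbhs1P[e e0 eU]].
  have [n0 hn] := cu _ (snbhs_ball V 0 (erefl : [set q] q) e0).
  by exists n0 => m n nm nn; have /= := hn m n nm nn; rewrite subr0.
have [n0 hn] := cu e e0; exists n0 => m n nm nn; apply: eU.
  exact: subspaceB.
by rewrite subr0; exact: hn.
Qed.

Lemma cvg_cauchy V q (u : nat -> E) x : subspace V -> seminorm_on V q -> V x ->
  (forall n, V (u n)) -> u @ \oo --> snbhs V [set q] x -> cauchy_in V [set q] u.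
Proof.
move=> sV sq Vx Vu /cvgP_snbhs[_ ux]; apply/cauchy_in_normP => // e e0.
have [|n0 _ hn] := ux q erefl (e / 2); first by rewrite divr_gt0.
exists n0 => m n /hn /= hm /hn /= hn'.
have := seminormB_le sV sq (Vu m) Vx (Vu n).
by rewrite (seminorm_distC sV sq Vx (Vu n)); lra.
Qed.

Lemma cvg_seminorm V q (u : nat -> E) x : subspace V -> seminorm_on V q -> V x ->
  (forall n, V (u n)) -> u @ \oo --> snbhs V [set q] x ->
  q (u n) @[n --> \oo] --> q x.
Proof.
move=> sV sq Vx Vu /cvgP_snbhs[_ ux]; apply/cvgrPdist_lt => e e0.
apply: filterS (ux q erefl e e0) => n /= une; apply: le_lt_trans une.
have V0 : V 0 by case: sV.
have := seminormB_le sV sq Vx (Vu n) V0; have := seminormB_le sV sq (Vu n) Vx V0.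
rewrite !subr0 (seminorm_distC sV sq Vx (Vu n)) ler_norml; lra.
Qed.

(** A Cauchy sequence of the closure converges in [X], and two approximations within [e / 2] put its
    limit back in the closure. *)
Lemma closure_banach X D : banach X -> subspace D -> D `<=` X ->
  banach {| carrier := closure_in X [set nrm X] D; nrm := nrm X |}.
Proof.
move=> [sX [nX nX0] cX] sD DX.
have sC := closure_in_subspace sX nX DX sD.
have CX x : closure_in X [set nrm X] D x -> carrier X x by case.
split=> //=.
  split; last by move=> x /CX; exact: nX0.
  by split=> [a x /CX|x y /CX Xx /CX]; [exact: nX.1|exact: nX.2].
move=> u Cu cu; have Xu n := CX _ (Cu n).
have {}cu : cauchy_in X [set nrm X] u.
  by apply/cauchy_in_normP => //; apply/(cauchy_in_normP _ Cu sC).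
have [x [Xx ux]] := cX u Xu cu.
have Cx : closure_in X [set nrm X] D x.
  split=> // U /snbhs1P[e e0 eU]; have e2 : 0 < e / 2 by rewrite divr_gt0.
  have /cvgP_snbhs[_ /(_ _ erefl _ e2) ux2] := ux; have [n /= un] := filter_ex ux2.
  have [_ /(_ _ (snbhs_ball X (u n) (erefl : [set nrm X] (nrm X)) e2))] := Cu n.
  move=> [d [Dd /= du]]; exists d; split=> //; apply: eU; first exact: DX.
  by have := seminormB_le sX nX (DX _ Dd) (Xu n) Xx; lra.
exists x; split=> //; apply/cvgP_snbhs; split; first exact: filterE.
by case/cvgP_snbhs: ux.
Qed.

Lemma isometry_inverse Y Z f : banach Y -> banach Z ->
  (forall y, carrier Y y -> carrier Z (f y)) -> linear_on Y f ->
  (forall y, carrier Y y -> nrm Z (f y) = nrm Y y) ->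
  (forall z, carrier Z z -> exists2 y, carrier Y y & f y = z) ->
  isometry Y Z f (inverse_on Y f) /\ {in carrier Y &, injective f}.
Proof.
move=> [sY [nY nY0] _] [sZ [nZ nZ0] _] fYZ lf nf sf.
have fI : {in carrier Y &, injective f}.
  move=> x y; rewrite !inE => Yx Yy fxy; apply/eqP; rewrite -subr_eq0; apply/eqP.
  apply: nY0; first exact: subspaceB.
  rewrite -nf; last exact: subspaceB.
  by rewrite (subspace_linearB sY lf)// fxy subrr (seminorm0 sZ nZ).
split=> //; split=> //.
- by move=> z /sf[y Yy <-]; rewrite inverse_onK.
- by move=> y Yy; rewrite inverse_onK.
- by move=> z /sf[y Yy <-]; rewrite inverse_onK.
Qed.

(** Linearity and preservation of norms, which [continuous_extension] does not assume, pass to the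
    limit along sequences of the dense [D]. For surjectivity, [z] is the limit of some [g (d n)]; as
    [g] preserves norms, [d] is Cauchy, and its limit is a preimage of [z]. *)
Lemma extension_isometry Y Z D g f : banach Y -> banach Z ->
  subspace D -> D `<=` Y -> Y `<=` closure_in Y [set nrm Y] D ->
  linear_on D g -> (forall x, D x -> nrm Z (g x) = nrm Y x) ->
  Z `<=` closure_in Z [set nrm Z] (g @` D) ->
  continuous_extension D g Y Z f ->
  isometry Y Z f (inverse_on Y f) /\ {in carrier Y &, injective f}.
Proof.
move=> bY bZ sD DY dD lg ng dZ [fYZ fg cf].
have [sY [nY nY0] cY] := bY; have [sZ [nZ nZ0] cZ] := bZ.
have hZ : hausdorff_in Z [set nrm Z] by exact: norm_hausdorff.
have gZ x : D x -> carrier Z (g x) by move=> Dx; rewrite -fg//; exact/fYZ/DY.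
have app y : carrier Y y -> exists d : nat -> E,
    [/\ forall n, D (d n), d @ \oo --> snbhs Y [set nrm Y] y &
      g (d n) @[n --> \oo] --> snbhs Z [set nrm Z] (f y)].
  move=> Yy; have [_ [d Dd dy]] := iffLR (closure_in_seqP _ _ DY) (dD _ Yy).
  exists d; split=> //; have : f (d n) @[n --> \oo] --> snbhs Z [set nrm Z] (f y).
    exact: cvg_trans (cvg_app f dy) (cf _ Yy).
  by under eq_fun do rewrite fg//.
apply: isometry_inverse => //.
- move=> a x y Yx Yy; have [c [Dc cx gcx]] := app _ Yx.
  have [d [Dd dy gdy]] := app _ Yy.
  have Yw : carrier Y (a *: x + y) by case: sY => _; exact.
  have Zw : carrier Z (a *: f x + f y) by case: sZ => _; apply; exact: fYZ.
  have semiY p : [set nrm Y] p -> seminorm_on Y p by move=> ->.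
  have semiZ p : [set nrm Z] p -> seminorm_on Z p by move=> ->.
  have /(_ _) cw := cvg_snbhs_linear (a := a) sY semiY Yx Yy cx dy.
  have /(_ _) gw := cvg_snbhs_linear (a := a) sZ semiZ (fYZ _ Yx) (fYZ _ Yy) gcx gdy.
  have fw : f (a *: c n + d n) @[n --> \oo] -->
      snbhs Z [set nrm Z] (f (a *: x + y)).
    exact: cvg_trans (cvg_app f cw) (cf _ Yw).
  have fgw : (fun n => f (a *: c n + d n)) = (fun n => a *: g (c n) + g (d n)).
    by apply/funext => n; rewrite -lg// fg//; case: sD => _; exact.
  rewrite fgw in fw; exact: (cvg_snbhs_unique hZ (fYZ _ Yw) Zw fw gw).
- move=> y Yy; have [d [Dd dy gdy]] := app _ Yy.
  have gd := cvg_seminorm sZ nZ (fYZ _ Yy) (fun n => gZ _ (Dd n)) gdy.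
  have := cvg_seminorm sY nY Yy (fun n => DY _ (Dd n)) dy.
  have -> : (fun n => nrm Y (d n)) = (fun n => nrm Z (g (d n))).
    by apply/funext => n; rewrite ng.
  exact: cvg_unique gd.
- move=> z Zz.
  have gDZ : g @` D `<=` Z by move=> _ [x Dx <-]; exact: gZ.
  have [_ [c Dc cz]] := iffLR (closure_in_seqP _ _ gDZ) (dZ _ Zz).
  have /choice[d hd] : forall n, exists x, D x /\ g x = c n.
    by move=> n; have [x Dx xc] := Dc n; exists x.
  have Dd n : D (d n) by case: (hd n).
  have gd n : g (d n) = c n by case: (hd n).
  have Zc n : carrier Z (c n) by exact: gDZ.
  have cc := cvg_cauchy sZ nZ Zz Zc cz.
  have [|y [Yy dy]] := cY d (fun n => DY _ (Dd n)).
    apply/cauchy_in_normP => [n||e e0]; [exact: DY|by []|].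
    have [n0 hn] := iffLR (cauchy_in_normP _ Zc sZ) cc e e0.
    exists n0 => m n nm nn; rewrite -ng; last exact: subspaceB.
    by rewrite (subspace_linearB sD lg)// !gd; exact: hn.
  have fd : f (d n) @[n --> \oo] --> snbhs Z [set nrm Z] (f y).
    exact: cvg_trans (cvg_app f dy) (cf _ Yy).
  have fdc : (fun n => f (d n)) = c by apply/funext => n; rewrite -gd fg.
  rewrite fdc in fd; exists y => //.
  exact: (cvg_snbhs_unique hZ (fYZ _ Yy) Zz fd cz).
Qed.
End NormedExtension.

(** * The scale of spaces *)
(** At 0 the resolvent condition concerns [- A], and a subspace absorbs the sign. *)
Lemma resolvent0_bij (R : realType) (k : scalar_kind)
    (E : lmodType (base_field R k)) (X : nspace E) (A : operator E) :
  subspace X -> resolvent_set X A 0 -> set_bij (dom A) X A.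
Proof.
move=> sX [[fA iA sA] _]; split.
- move=> x Ax; have := fA x Ax; rewrite scale0r sub0r => XA.
  by rewrite -[A x]opprK -scaleN1r; exact: subspaceZ.
- by move=> x y Ax Ay xy; apply: iA => //; rewrite !scale0r xy.
- move=> y Xy; have [|x Ax] := sA (- y).
    by rewrite -scaleN1r; exact: subspaceZ.
  by rewrite scale0r sub0r => /oppr_inj <-; exists x.
Qed.

Section Scale.
Context {R : realType} {k : scalar_kind} {E : lmodType (base_field R k)}.
Variables (X : nspace E) (P : set (E -> R)) (T : R -> E -> E).
Variables (Xu : nat -> nspace E) (Au : nat -> E -> E).
Hypothesis hP : norming X P.
Hypothesis hT : bicontinuous_semigroup X P T.
Let A := generator X P T.
Hypothesis A_bij : set_bij (dom A) X A.
Hypothesis hXu : extrapolation_tower X A Xu Au.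

Let bX : banach X := aS_banach (bs_assumption_S hT).
Let sX : subspace X. Proof. by case: bX. Qed.
Let nX : seminorm_on X (nrm X). Proof. by case: bX => _ []. Qed.
Let sA : subspace (dom A) := generator_subspace hT.
Let lA : linear_on (dom A) A.
Proof. by move=> a x y Ax Ay; case: (generator_linear hT a Ax Ay). Qed.
Let AX : dom A `<=` X.
Proof. by move=> x /generator_carrier[]. Qed.
Let XA x : dom A x -> carrier X (A x).
Proof. by move=> /generator_carrier[]. Qed.
Let surA y : carrier X y -> exists2 x, dom A x & A x = y.
Proof. by case: A_bij => _ _; exact. Qed.
Let AK x : dom A x -> op_inv A (A x) = x.
Proof. by move=> Ax; apply: inverse_onK => //; case: A_bij. Qed.

Lemma tower_carrier0 : carrier (Xu 0) = closure_in X [set nrm X] (dom A).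
Proof. by rewrite (et_zero hXu). Qed.

Lemma tower_banach n : banach (Xu n).
Proof.
case: n => [|[|n]].
- by rewrite (et_zero hXu); exact: closure_banach.
- by case: (et_space1 hXu).
- by case: (et_space hXu (ltn0Sn n)).
Qed.

Lemma dom_generator_tower : dom A `<=` Xu 0.
Proof. by rewrite tower_carrier0; exact: closure_in_subset. Qed.

Lemma tower_subset n : Xu n `<=` Xu n.+1.
Proof.
case: n => [|n]; last by case: (et_space hXu (ltn0Sn n)).
rewrite tower_carrier0 => x [Xx _].
by case: (et_space1 hXu) => _ + _ _; exact.
Qed.

Lemma tower_extends n x : carrier (Xu n) x -> Au n.+2 x = Au n.+1 x.
Proof. by case: (et_op hXu (ltn0Sn n)) => _ + _; exact. Qed.

Lemma tower_extends0 x : dom A x -> Au 1 x = A x.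
Proof. by case: (et_op1 hXu) => _ + _; exact. Qed.

(** Only [n = 0] needs work, since [Xu 1] completes [X] and not [Xu 0]. A point of [X] is some
    [A z]; approximating [z] by [v] with [v] and [A v] in [dom A] gives [A v] in [Xu 0], at distance
    [|v - z|] from [A z] in [Xu 1]. *)
Lemma tower_dense n : Xu n.+1 `<=` closure_in (Xu n.+1) [set nrm (Xu n.+1)] (Xu n).
Proof.
case: n => [|n]; last by case: (et_space hXu (ltn0Sn n)).
have [[sX1 [nX1 _] _] XX1 nE dX] := et_space1 hXu.
move=> x X1x; split=> // U /snbhs1P[e e0 eU]; have e2 : 0 < e / 2 by rewrite divr_gt0.
have [y [Xy /= yx]] := (dX x X1x).2 _ (snbhs_ball _ x (erefl : [set nrm (Xu 1)] _) e2).
have [z Az zy] := surA Xy.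
have [v [Av AAv vz]] := generator_square_dense hT hP Az e2 A_bij.
have X1A w : dom A w -> carrier (Xu 1) (A w) by move=> Aw; exact/XX1/XA.
exists (A v); split; first exact: dom_generator_tower.
apply: eU; first exact: X1A.
have : nrm (Xu 1) (A v - A z) < e / 2.
  rewrite -(subspace_linearB sA lA)// nE; last by apply: XA; exact: subspaceB.
  by rewrite AK//; exact: subspaceB.
by have := seminormB_le sX1 nX1 (X1A _ Av) (X1A _ Az) X1x; rewrite zy; lra.
Qed.

(** Each operator extends the previous one, whose range is dense in the next space by completion.
    Injectivity is carried along because the norms of the tower are written with [inverse_on], which
    computes under injectivity. *)
Lemma tower_isometry n :
  isometry (Xu n) (Xu n.+1) (Au n.+1) (inverse_on (Xu n) (Au n.+1)) /\
  {in carrier (Xu n) &, injective (Au n.+1)}.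
Proof.
elim: n => [|n [IH inj]].
  have [_ XX1 nE dX] := et_space1 hXu.
  apply: (extension_isometry (tower_banach 0) (tower_banach 1) sA
    dom_generator_tower _ lA _ _ (et_op1 hXu)).
  - move=> x X0x; split=> // U /snbhs1P[e e0 eU].
    move: (X0x); rewrite tower_carrier0 => -[Xx] /(_ [set y | nrm X (y - x) < e]).
    move=> [|y [Ay yx]]; first exact: snbhs_ball.
    exists y; split=> //; apply: eU; first exact: dom_generator_tower.
    by rewrite (et_zero hXu).
  - by move=> x Ax; rewrite nE ?AK ?(et_zero hXu)//; exact: XA.
  - have -> // : A @` dom A = X.
    apply/seteqP; split=> [_ [x Ax <-]|y Xy]; first exact: XA.
    by have [x Ax <-] := surA Xy; exists x.
have [_ X12 nE dX] := et_space hXu (ltn0Sn n).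
apply: (extension_isometry (tower_banach n.+1) (tower_banach n.+2)
  (iso_subspace IH) (@tower_subset n) (@tower_dense n) (iso_linear IH) _ _
  (et_op hXu (ltn0Sn n))).
- by move=> x Xx; rewrite nE ?inverse_onK//; exact: (iso_fun IH).
- have -> // : Au n.+1 @` Xu n = Xu n.+1.
  apply/seteqP; split=> [_ [x Xx <-]|y Xy]; first exact: (iso_fun IH).
  by exists (inverse_on (Xu n) (Au n.+1) y);
    [exact: (iso_inv IH)|exact: (iso_invK IH)].
Qed.

Lemma image_tower n : Au n.+1 @` Xu n = Xu n.+1.
Proof.
have [fg _] := tower_isometry n.
apply/seteqP; split=> [_ [x Xx <-]|y Xy]; first exact: (iso_fun fg).
by exists (inverse_on (Xu n) (Au n.+1) y); [exact: (iso_inv fg)|exact: (iso_invK fg)].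
Qed.

Let strong_space (Y : nspace E) (S : R -> E -> E) : set E :=
  [set x | carrier Y x /\ strongly_continuous_at Y [set nrm Y] S x].

(** * The levels [n >= 0] *)

Section Positive.
Local Notation Xp := (Xpos X P T).
Local Notation Ap := (Apos X P T).

Lemma Xpos0 : Xp 0 = X.
Proof. by rewrite /Xpos; case: (X). Qed.

Lemma Xpos_subset n : Xp n.+1 `<=` Xp n.
Proof.
elim: n => [x [/AX]//|n IH x [Ax Xx]]; split=> //; exact: IH.
Qed.

Lemma dom_Apos n : dom (Ap n) = Xp n.+1.
Proof.
apply/seteqP; split=> [x [Ax _ XAx]//|x /= Xx].
by split; [case: Xx|exact: Xpos_subset|case: Xx].
Qed.

Lemma Xpos_subspace n : subspace (Xp n).
Proof.
elim: n => [//|n IH]; split.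
  split; first by case: sA.
  by rewrite -/A (subspace_linear0 sA lA); case: IH.
move=> a x y [Ax Xx] [Ay Xy]; split; first by case: sA => _; exact.
by rewrite lA//; case: IH => _; exact.
Qed.

(** The norm of [A x] in [X_n] is by definition that of [x] in [X_{n+1}], and a preimage under [A]
    of a point of [D(A^n)] is automatically in [D(A^(n+1))]. *)
Lemma Apos_isometry n : isometry (Xp n.+1) (Xp n) (Ap n) (op_inv (Ap n)).
Proof.
have surj y : carrier (Xp n) y -> exists2 x, carrier (Xp n.+1) x & A x = y.
  move=> Xy; have Xy' : carrier X y.
    by elim: n y Xy => [//|n IH] y /Xpos_subset/IH.
  have [x Ax xy] := surA Xy'.
  by exists x => //; split=> //; rewrite -/A xy.
have K x : carrier (Xp n.+1) x -> op_inv (Ap n) (Ap n x) = x.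
  rewrite -dom_Apos => Xx; apply: inverse_onK Xx.
  move=> u v; rewrite !inE => -[Au' _ _] [Av _ _] uv.
  by rewrite -(AK Au') -(AK Av); congr op_inv.
split=> //.
- exact: Xpos_subspace.
- by move=> x [].
- by move=> y /surj[x Xx <-]; rewrite K.
- by move=> y /surj[x Xx <-]; rewrite K.
- by move=> a x y [Ax _] [Ay _]; exact: lA.
- by move=> x Xx /=; rewrite -iterSr.
Qed.

(** Induction by transport along the inverse of [A_n]. The transported domain is the set of [y] in
    [X_{n+1}] with [A y] in [X_{n+1}], that is [X_{n+2}]. *)
Lemma positive_scale n :
  let S := Tpos X P T n in
  [/\ bicontinuous_semigroup (Xp n) (Ppos X P T n) S,
      same_operator (generator (Xp n) (Ppos X P T n) S) (Ap n) &
      dom_pow (under0 X A) (part A (under0 X A)) n = strong_space (Xp n) S].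
Proof.
elim: n => [|n [hTn [domn eqn] SCn]] S.
  rewrite /Apos Xpos0; split.
  - exact: hT.
  - split=> //; apply/seteqP; split=> [x Ax|x []//].
    by split=> //; [exact: AX|exact: XA].
  - exact: (strong_continuity_space hT hP A_bij).
have gf := Apos_isometry n; have fg := isometry_sym gf.
have PQ := matched_comp (Ppos X P T n) fg.
have TS t x : 0 <= t -> carrier (Xp n) x ->
    S t (op_inv (Ap n) x) = op_inv (Ap n) (Tpos X P T n t x).
  move=> t0 Xx; congr (op_inv _ (Tpos X P T n t _)).
  exact: (iso_invK gf).
split.
- exact: (transport_semigroup fg PQ hTn TS).
- split.
    apply/seteqP; split=> [y /(transport_generator fg PQ hTn TS)[Yy]|y].
      by rewrite domn dom_Apos => Xy; rewrite dom_Apos; split=> //; case: Yy.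
    rewrite dom_Apos => Xy; apply/(transport_generator fg PQ hTn TS).
    by split; [exact: Xpos_subset|rewrite domn dom_Apos; case: Xy].
  move=> y Ay; rewrite (transport_generatorE fg PQ hTn TS Ay).
  have [Xy Ay'] := iffLR (transport_generator fg PQ hTn TS y) Ay.
  rewrite eqn// (iso_funK gf)//; move: Ay'; rewrite domn dom_Apos; exact.
- rewrite /strong_space (transport_strong_continuity_space fg hTn TS).
  rewrite -/(strong_space _ _) -SCn; apply/seteqP; split.
    move=> x [[Ax Ux UAx] DAx]; exists (A x) => //; apply: (iso_funK gf).
    split=> //; have : strong_space (Xp n) (Tpos X P T n) (A x) by rewrite -SCn.
    by case.
  (* The inverse image [y] of [x] is in [dom A], hence in its closure, and [A y = x] is in that
     closure too: this is membership in the domain of the part of [A]. *)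
  move=> _ [x Dx <-]; have : strong_space (Xp n) (Tpos X P T n) x by rewrite -SCn.
  move=> [Xx _]; have Yy := iso_inv gf Xx; have AyE := iso_invK gf Xx.
  have Ux : closure_in X [set nrm X] (dom A) x by case: (n) Dx => [//|m] [[]].
  have [Ay _] := Yy; split; last by rewrite [X in dom_pow _ _ _ X]AyE.
  split=> //; last by rewrite [X in carrier _ X]AyE.
  exact: closure_in_subset.
Qed.
End Positive.

(** * The levels [n <= 0], inside the extrapolation tower *)

Section Negative.
Local Notation Xn := (Xneg X Xu Au).
Local Notation An := (Aneg X Xu Au).
Local Notation Pn := (Pneg X P Xu Au).
Local Notation Tn := (Tneg X T Xu Au).

(** The index is shifted by one because [X] itself embeds in [Xu 1] and not in [Xu 0]. *)
Lemma Xneg_subset n : Xn n `<=` Xu n.+1.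
Proof.
elim: n => [x Xx|n IH _ [x Xx <-]]; first by case: (et_space1 hXu) => _ + _ _; exact.
by have [fg _] := tower_isometry n.+1; exact/(iso_fun fg)/IH.
Qed.

(** This restricts the tower isometry of level [n.+1]; by injectivity, its inverse agrees with the
    inverse taken on the smaller set [X_{-n}]. *)
Lemma Aneg_isometry n : subspace (Xn n) ->
  isometry (Xn n) (Xn n.+1) (Au n.+2) (op_inv (An n)).
Proof.
move=> sn; have [fg inj] := tower_isometry n.+1.
have XU := @Xneg_subset n.
have K x : carrier (Xn n) x -> op_inv (An n) (Au n.+2 x) = x.
  by move=> Xx; apply: inverse_onK Xx => u v; rewrite !inE => /XU Uu /XU Uv;
    apply: inj; rewrite inE.
split=> //.
- by move=> x Xx; exists x.
- by move=> _ [x Xx <-]; rewrite K.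
- by move=> _ [x Xx <-]; rewrite K.
- by move=> a x y /XU Ux /XU Uy; exact: (iso_linear fg).
- by move=> x /XU Ux /=; rewrite inverse_onK.
Qed.

(** This is [A_{-n}]: [Aneg m] has index [-(m + 1)], and level 0 carries [A]. *)
Let op n := if n is m.+1 then An m else A.

Lemma negative_scale n :
  [/\ bicontinuous_semigroup (Xn n) (Pn n) (Tn n),
      same_operator (generator (Xn n) (Pn n) (Tn n)) (op n) &
      carrier (Xu n) = strong_space (Xn n) (Tn n)].
Proof.
elim: n => [|n [hTn [domn eqn] SCn]].
  by split; rewrite // tower_carrier0; exact: (strong_continuity_space hT hP A_bij).
have [sn _ _] := aS_banach (bs_assumption_S hTn).
have fg := Aneg_isometry sn; have gf := isometry_sym fg.
have PQ := matched_comp (Pn n) fg.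
have TS t x : 0 <= t -> carrier (Xn n) x ->
    Tn n.+1 t (Au n.+2 x) = Au n.+2 (Tn n t x).
  by move=> t0 Xx; rewrite /= (iso_funK fg).
(* The isometry used for transport extends [A_{-n}], so conjugating [A_{-n}] by it gives its own
   restriction to [X_{-n}]. *)
have opE x : dom (op n) x -> Au n.+2 x = op n x.
  case: (n) => [|m] Ax.
    by rewrite tower_extends ?tower_extends0//; exact: dom_generator_tower.
  by rewrite tower_extends//; exact: Xneg_subset.
(* The transported domain is the image of the domain of [A_{-n}], hence its range [X_{-n}], which is
   the domain of [A_{-n-1}]. *)
have op_image : op n @` dom (op n) = Xn n.
  case: (n) => [|m] //; apply/seteqP; split=> [_ [x Ax <-]|y Xy]; first exact: XA.
  by have [x Ax <-] := surA Xy; exists x.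
split.
- exact: (transport_semigroup fg PQ hTn TS).
- split.
    apply/seteqP; split=> [y /(transport_generator fg PQ hTn TS)[Yy]|y].
      rewrite domn => Ay; rewrite /= -op_image; exists (op_inv (An n) y) => //.
      by rewrite -opE// (iso_invK fg).
    move=> Xy; have [x Ax <-] : (op n @` dom (op n)) y by rewrite op_image.
    apply/(transport_generator fg PQ hTn TS).
    have Xx : carrier (Xn n) x by have := Ax; rewrite -domn => /generator_carrier[].
    rewrite -opE// (iso_funK fg)// domn; split=> //; exact: (iso_fun fg).
  move=> y Ay; rewrite (transport_generatorE fg PQ hTn TS Ay).
  have [Xy Ay'] := iffLR (transport_generator fg PQ hTn TS y) Ay.
  rewrite eqn// -opE; last by rewrite -domn.
  by rewrite (iso_invK fg).
- rewrite /strong_space (transport_strong_continuity_space fg hTn TS).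
  (* [Au n.+2] and [Au n.+1] agree on [Xu n], so both map it onto [Xu n.+1]. *)
  rewrite -/(strong_space _ _) -SCn -image_tower; apply: eq_imagel => x Xx.
  by rewrite tower_extends.
Qed.
End Negative.
End Scale.

(** * Both halves of the scale joined over the integers *)

Theorem proposition4p12 (R : realType) (k : scalar_kind)
    (E : lmodType (base_field R k)) (X0 : nspace E) (P : set (E -> R))
    (T : R -> E -> E) (Xu : nat -> nspace E) (Au : nat -> E -> E)
    (hS : assumption_S X0 P) (hP : norming X0 P)
    (hT : bicontinuous_semigroup X0 P T)
    (h0 : resolvent_set X0 (generator X0 P T) 0)
    (hXu : extrapolation_tower X0 (generator X0 P T) Xu Au)
    (n : int) :
  let Xn := scale_space X0 P T Xu Au n in
  let An := scale_operator X0 P T Xu Au n in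
  let Pn := scale_seminorms X0 P T Xu Au n in
  let Tn := scale_semigroup X0 P T Xu Au n in
  [/\ bicontinuous_semigroup Xn Pn Tn,
      same_operator (generator Xn Pn Tn) An,
      dom An = scale_space X0 P T Xu Au (n + 1)
    & under_space X0 P T Xu n =
      [set x | carrier Xn x /\ strongly_continuous_at Xn [set nrm Xn] Tn x]].
Proof.
have [sX _ _] := aS_banach hS.
have A_bij := resolvent0_bij sX h0.
case: n => m Xn An Pn Tn.
  have [hTn genE SCE] := positive_scale hP hT A_bij m.
  by split=> //; rewrite addrC -intS; exact: dom_Apos.
have [hTn genE SCE] := negative_scale hP hT A_bij hXu m.+1.
(* The successor of [Negz 0] is the nonnegative index 0, with carrier that of [X0]; that of
   [Negz m.+1] is [Negz m]. *)
split=> //; case: m @Xn @An @Pn @Tn {hTn genE SCE} => [|m] Xn An Pn Tn //.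
have -> // : Negz m.+1 + 1 = Negz m by rewrite -[LHS]/(Negz (m.+1 - 1)) subn1.
Qed.
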